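(* (1) Let $H$ be a Hilbert space. Then the C*-algebra $K(H)$ of all compact operators on $H$ does not have an uncountable $C^*_0$-polyhedron. (2) The C*-algebra $B(\ell_2)$ of all bounded operators on $\ell_2$ does not have an uncountable C*-polyhedron consisting of compact operators, and it does not have an uncountable $C^*_0$-polyhedron consisting of self-adjoint elements.
   Context: Hilbert spaces are complex. Let $\mathcal{A}$ be a unital C*-algebra. A set $\mathcal{X}\subset\mathcal{A}$ is C*-convex if $\sum_{i=1}^n A_i^*x_iA_i\in\mathcal{X}$ whenever $n\ge 1$, $x_1,\dots,x_n\in\mathcal{X}$ and $A_1,\dots,A_n\in\mathcal{A}$ satisfy $\sum_{i=1}^n A_i^*A_i=1$. For $S\subset\mathcal{A}$, $MCL(S)$ denotes the smallest norm-closed C*-convex subset of $\mathcal{A}$ containing $S$. A family $(a_\alpha)_{\alpha<\kappa}$ in $\mathcal{A}$ is a C*-polyhedron of size $\kappa$ if for every $\alpha<\kappa$, $a_\alpha\notin MCL(\{a_\beta:\beta<\kappa,\ \beta\neq\alpha\})$; it is a $C^*_0$-polyhedron of size $\kappa$ if for every $\alpha<\kappa$, $a_\alpha\notin MCL(\{a_\beta:\beta<\kappa,\ \beta\neq\alpha\}\cup\{0\})$. Such a family is uncountable if $\kappa$ is uncountable. For a nonunital C*-algebra $\mathcal{A}$, a C*-polyhedron ($C^*_0$-polyhedron) in $\mathcal{A}$ means a family of elements of $\mathcal{A}$ that is a C*-polyhedron ($C^*_0$-polyhedron) in the unitization $\tilde{\mathcal{A}}$; for $K(H)$ with $H$ infinite-dimensional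 the unitization is the C*-algebra generated by $K(H)$ and the identity of $B(H)$. *)

(* Defs.v *)
From HB Require Import structures.
From mathcomp Require Import all_boot all_order all_algebra.
From mathcomp Require Import ring lra complex.
From mathcomp Require Import boolp classical_sets functions cardinality reals.
From mathcomp Require Import topology normedtype sequences.
Set Implicit Arguments.
Unset Strict Implicit.
Unset Printing Implicit Defensive.

Import Order.TTheory GRing.Theory Num.Theory.
Import numFieldNormedType.Exports.

Local Open Scope classical_set_scope.
Local Open Scope ring_scope.
Local Open Scope complex_scope.

(* The norm topology on the complex numbers R[i]. *)
HB.instance Definition _ (R : realType) := NormedModule.copy R[i] R[i]^o.

(* The inner product is linear in its first argument. *)
HB.mixin Record CompleteNormedModule_isHilbert (R : realType) H
    of CompleteNormedModule R[i] H := {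
  inner : {dot H for (@Num.conj R[i])};
  inner_norm : forall x : H, inner x x = `|x| ^+ 2 }.

#[short(type="hilbertType")]
HB.structure Definition Hilbert (R : realType) :=
  {H of CompleteNormedModule R[i] H & CompleteNormedModule_isHilbert R H}.

Lemma normr_RRe (R : realType) (V : normedModType R[i]) (x : V) :
  (complex.Re `|x|)%:C = `|x|.
Proof. by rewrite RRe_real ?normr_real. Qed.

Section BoundedOperators.
Variables (R : realType) (H : hilbertType R).

Definition bounded_linear : {pred H -> H} :=
  [pred T : H -> H |
    `[< linear T /\ exists M : R, forall x, `|T x| <= M%:C * `|x| >]].

Lemma bounded_linear_submod_closed : submod_closed bounded_linear.
Proof.
split=> [|c S T /asboolP[Sl [M SM]] /asboolP[Tl [N TN]]]; apply/asboolP; split.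
- by move=> a x y; rewrite /= scaler0 addr0.
- by exists 0 => x; rewrite normr0 mul0r.
- by move=> a x y; rewrite !fctE/= Sl Tl !scalerDr !scalerA mulrC addrACA.
exists (Normc.normc c * M + N) => x.
rewrite rmorphD rmorphM/= mulrDl (le_trans (ler_normD _ _))// lerD//.
by rewrite normrZ -mulrA ler_wpM2l.
Qed.

HB.instance Definition _ :=
  GRing.isSubmodClosed.Build R[i] (H -> H) bounded_linear
    bounded_linear_submod_closed.

Record boundedOp := BoundedOp {
  boundedOp_fun :> H -> H;
  boundedOpP : boundedOp_fun \in bounded_linear }.

HB.instance Definition _ := [isSub for boundedOp_fun].
HB.instance Definition _ := [Choice of boundedOp by <:].
HB.instance Definition _ := [SubChoice_isSubLmodule of boundedOp by <:].

End BoundedOperators.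

Section BoundedOperatorNorm.
Variables (R : realType) (H : hilbertType R).
Local Notation boundedOp := (boundedOp H).
Implicit Types (S T : boundedOp) (x y : H).

Lemma boundedOp_linear T : linear T.
Proof. by have /asboolP[] := boundedOpP T. Qed.

Lemma boundedOp_bounded T : exists M : R, forall x, `|T x| <= M%:C * `|x|.
Proof. by have /asboolP[] := boundedOpP T. Qed.

HB.instance Definition _ T :=
  GRing.isLinear.Build R[i] H H *:%R T (boundedOp_linear T).

Lemma boundedOp_ext S T : S =1 T -> S = T.
Proof. by move=> ST; apply/val_inj/funext. Qed.

Lemma boundedOp_addE S T x : (S + T) x = S x + T x. Proof. by []. Qed.
Lemma boundedOp_oppE T x : (- T) x = - T x. Proof. by []. Qed.
Lemma boundedOp_scaleE (c : R[i]) T x : (c *: T) x = c *: T x.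
Proof. by []. Qed.
Lemma boundedOp_zeroE x : (0 : boundedOp) x = 0. Proof. by []. Qed.

Definition opnorm T : R :=
  sup [set complex.Re `|T x| | x in [set x : H | `|x| <= 1]].

Lemma opnorm_has_sup T :
  has_sup [set complex.Re `|T x| | x in [set x : H | `|x| <= 1]].
Proof.
split; first by exists (complex.Re `|T 0|), 0 => //=; rewrite normr0 ler01.
have [M MT] := boundedOp_bounded T.
exists (Num.max M 0) => _ [x /= x1 <-]; rewrite -lecR normr_RRe.
apply: (le_trans (MT x)); have M0 : (M%:C <= (Num.max M 0)%:C).
  by rewrite lecR le_max lexx.
apply: (le_trans (ler_wpM2r _ M0)) => //.
by rewrite -[leRHS]mulr1 ler_wpM2l// ler0c le_max lexx orbT.
Qed.

Lemma opnorm_ge0 T : 0 <= opnorm T.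
Proof.
apply: (ub_le_sup (opnorm_has_sup T).2); exists 0; first by rewrite /= normr0.
by rewrite linear0 normr0.
Qed.

Lemma opnormP T x : `|T x| <= (opnorm T)%:C * `|x|.
Proof.
have [->|x0] := eqVneq x 0; first by rewrite linear0 !normr0 mulr0.
have nx : 0 < `|x| by rewrite normr_gt0.
rewrite -ler_pdivrMr// mulrC -[in leLHS](ger0_norm (ltW nx)) -normfV -normrZ.
rewrite -linearZ/= -normr_RRe lecR.
apply: (ub_le_sup (opnorm_has_sup T).2); exists (`|x|^-1 *: x) => //=.
by rewrite normfZV.
Qed.

Lemma opnorm_le T (M : R) :
  0 <= M -> (forall x, `|T x| <= M%:C * `|x|) -> opnorm T <= M.
Proof.
move=> M0 MT; apply: ge_sup => [|_ [x /= x1 <-]].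
  exact: (opnorm_has_sup T).1.
rewrite -lecR normr_RRe (le_trans (MT x))// -[leRHS]mulr1 ler_wpM2l//.
by rewrite ler0c.
Qed.

Let norm T : R[i] := (opnorm T)%:C.

Lemma ler_opnormD S T : norm (S + T) <= norm S + norm T.
Proof.
rewrite /norm -rmorphD lecR opnorm_le ?addr_ge0 ?opnorm_ge0// => x.
by rewrite rmorphD mulrDl (le_trans (ler_normD _ _))// lerD// opnormP.
Qed.

Let opnormZ_le (c : R[i]) T : norm (c *: T) <= `|c| * norm T.
Proof.
have -> : `|c| = (Normc.normc c)%:C by [].
rewrite /norm -rmorphM lecR opnorm_le// => [|x].
  by rewrite mulr_ge0 ?opnorm_ge0// -lecR; exact: (normr_ge0 c).
rewrite rmorphM -mulrA boundedOp_scaleE normrZ.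
by rewrite [leRHS](_ : _ = `|c| * ((opnorm T)%:C * `|x|))// ler_wpM2l// opnormP.
Qed.

Lemma opnormZ (c : R[i]) T : norm (c *: T) = `|c| * norm T.
Proof.
apply/eqP; rewrite eq_le opnormZ_le/=.
have [->|c0] := eqVneq c 0; first by rewrite normr0 mul0r ler0c opnorm_ge0.
rewrite mulrC -ler_pdivlMr ?normr_gt0// mulrC -normfV.
by rewrite (le_trans _ (opnormZ_le _ _))// scalerK.
Qed.

Lemma opnorm_eq0 T : norm T = 0 -> T = 0.
Proof.
move=> [T0]; apply: boundedOp_ext => x; apply/eqP; rewrite -normr_le0.
by rewrite (le_trans (opnormP T x))// T0 mul0r.
Qed.

HB.instance Definition _ :=
  Lmodule_isNormed.Build R[i] boundedOp ler_opnormD opnormZ opnorm_eq0.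

Lemma bounded_linear_id : idfun \in @bounded_linear R H.
Proof.
by apply/asboolP; split=> //; exists 1 => x; rewrite mul1r.
Qed.

Lemma bounded_linear_comp S T : S \o T \in @bounded_linear R H.
Proof.
apply/asboolP; split=> [c x y|]; first by rewrite /= !linearP.
exists (opnorm S * opnorm T) => x.
rewrite rmorphM -mulrA (le_trans (opnormP S _))//.
by rewrite ler_wpM2l ?opnormP// ler0c opnorm_ge0.
Qed.

Definition boundedOp_one : boundedOp := BoundedOp bounded_linear_id.
Definition boundedOp_mul S T : boundedOp := BoundedOp (bounded_linear_comp S T).

Let boundedOp_mulA : associative boundedOp_mul.
Proof. by move=> S T U; exact: boundedOp_ext. Qed.

Let boundedOp_mul1l : left_id boundedOp_one boundedOp_mul.
Proof. by move=> T; exact: boundedOp_ext. Qed.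

Let boundedOp_mul1r : right_id boundedOp_one boundedOp_mul.
Proof. by move=> T; exact: boundedOp_ext. Qed.

Let boundedOp_mulDl : left_distributive boundedOp_mul +%R.
Proof. by move=> S T U; exact: boundedOp_ext. Qed.

Let boundedOp_mulDr : right_distributive boundedOp_mul +%R.
Proof. by move=> S T U; apply: boundedOp_ext => x /=; exact: linearD. Qed.

HB.instance Definition _ := GRing.Zmodule_isPzRing.Build boundedOp
  boundedOp_mulA boundedOp_mul1l boundedOp_mul1r
  boundedOp_mulDl boundedOp_mulDr.

Lemma boundedOp_normE T : `|T| = (opnorm T)%:C. Proof. by []. Qed.
Lemma boundedOp_mulE S T x : (S * T) x = S (T x). Proof. by []. Qed.
Lemma boundedOp_oneE x : (1 : boundedOp) x = x. Proof. by []. Qed.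

End BoundedOperatorNorm.

Section HilbertSpaceTheory.
Variables (R : realType) (H : hilbertType R).
Implicit Types x y z : H.

Lemma innerC x y : inner x y = (inner y x)^*.
Proof. by rewrite (hermC (inner : {dot H for _})) /= expr0 mul1r. Qed.

Lemma innerDl x y z : inner (x + y) z = inner x z + inner y z.
Proof. exact: linearDl. Qed.

Lemma innerZl (c : R[i]) x y : inner (c *: x) y = c * inner x y.
Proof. exact: linearZl_LR. Qed.

Lemma innerDr x y z : inner x (y + z) = inner x y + inner x z.
Proof. by rewrite innerC innerDl rmorphD/= -!innerC. Qed.

Lemma innerZr (c : R[i]) x y : inner x (c *: y) = c^* * inner x y.
Proof. by rewrite innerC innerZl rmorphM/= -innerC. Qed.

Lemma inner0l x : inner 0 x = 0.
Proof. by rewrite -(scale0r 0) innerZl mul0r. Qed.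

Lemma innerNl x y : inner (- x) y = - inner x y.
Proof. by rewrite -scaleN1r innerZl mulN1r. Qed.

Lemma inner_inj x y : (forall z, inner z x = inner z y) -> x = y.
Proof.
move=> xy; apply/eqP; rewrite -subr_eq0 -normr_eq0 -sqrf_eq0 -inner_norm.
by rewrite innerDr -scaleN1r innerZr rmorphN1 mulN1r xy subrr.
Qed.

Definition re_inner x y : R := complex.Re (inner x y).
Definition rnorm x : R := complex.Re `|x|.
Local Notation b := re_inner.
Local Notation n := rnorm.

Lemma rnormE x : (n x)%:C = `|x|.
Proof. exact: normr_RRe. Qed.


Let bC x y : b x y = b y x.
Proof. by rewrite /re_inner innerC; case: (inner y x). Qed.
Let bDl x y z : b (x + y) z = b x z + b y z.
Proof. by rewrite /re_inner innerDl raddfD. Qed.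
Let bZl (t : R) x y : b (t%:C *: x) y = t * b x y.
Proof.
by rewrite /re_inner innerZl; case: (inner x y) => u v /=; rewrite mul0r subr0.
Qed.
Let bDr x y z : b z (x + y) = b z x + b z y.
Proof. by rewrite bC bDl !(bC z). Qed.
Let bZr (t : R) x y : b y (t%:C *: x) = t * b y x.
Proof. by rewrite bC bZl (bC y). Qed.
Let bn x : b x x = n x ^+ 2.
Proof. by rewrite /re_inner inner_norm -rnormE -rmorphXn. Qed.
Let n_ge0 x : 0 <= n x.
Proof. by rewrite -ler0c rnormE. Qed.
Let bNl x y : b (- x) y = - b x y.
Proof. by rewrite /re_inner innerNl raddfN. Qed.
Let bNr x y : b x (- y) = - b x y.
Proof. by rewrite bC bNl bC. Qed.

Let b_CS x y : b x y ^+ 2 <= n x ^+ 2 * n y ^+ 2.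
Proof.
have [->|y0] := eqVneq y 0.
  by rewrite /re_inner innerC inner0l conjc0 /= expr0n/= mulr_ge0 ?sqr_ge0.
have ny : 0 < n y ^+ 2.
  by rewrite exprn_gt0// -ltcR rnormE normr_gt0.
have := sqr_ge0 (n (x + (- (b x y / n y ^+ 2))%:C *: y)).
rewrite -(bn (x + _)) !(bDl, bDr, bZl, bZr) !bn (bC y x) => h.
rewrite -ler_pdivrMr// -subr_ge0 (le_trans h)// le_eqVlt; apply/orP; left.
by apply/eqP; field; rewrite -sqrf_eq0 gt_eqF.
Qed.

Let b_le x y : `|b x y| <= n x * n y.
Proof.
by rewrite -(@ler_pXn2r _ 2)// ?nnegrE ?mulr_ge0// exprMn real_normK ?num_real.
Qed.

Lemma riesz_re (f : {linear H -> R[i]}) (M : R) :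
  (forall x, `|f x| <= M%:C * `|x|) ->
  exists z, forall x, complex.Re (f x) = b x z.
Proof.
move=> fM; pose g x := complex.Re (f x).
have gD x y : g (x + y) = g x + g y by rewrite /g linearD raddfD.
have gZ (t : R) x : g (t%:C *: x) = t * g x.
  by rewrite /g linearZ/=; case: (f x) => u v /=; rewrite mul0r subr0.
have gM x : g x <= M * n x.
  rewrite -lecR rmorphM/= rnormE (le_trans _ (fM x))//.
  by rewrite (le_trans _ (normc_ge_Re _))// lecR ler_norm.
pose J x := n x ^+ 2 - 2 * g x.
have J_inf : has_inf (range J).
  split; first by exists (J 0), 0.
  exists (- M ^+ 2) => _ [x _ <-]; rewrite /J.
  have := gM x; have := sqr_ge0 (n x - M); nra.
pose m := inf (range J).
have Jm x : m <= J x by apply: (ge_inf J_inf.2); exists x.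
have JD x y (t : R) :
    J (x + t%:C *: y) = J x + 2 * t * (b y x - g y) + t ^+ 2 * n y ^+ 2.
  rewrite /J gD gZ -(bn (x + _)) !(bDl, bDr, bZl, bZr) !bn (bC x y); ring.
have var x y (e : R) : J x < m + e -> (b y x - g y) ^+ 2 <= e * n y ^+ 2.
  move=> Jx; have [->|y0] := eqVneq y 0.
    have -> : g 0 = 0 by rewrite /g linear0.
    have -> : b 0 x = 0 by rewrite /re_inner inner0l.
    have -> : n 0 = 0 by rewrite /rnorm normr0.
    by rewrite subrr expr0n/= mulr0.
  have ny : 0 < n y ^+ 2 by rewrite exprn_gt0// -ltcR rnormE normr_gt0.
  have := Jm (x + (- ((b y x - g y) / n y ^+ 2))%:C *: y).
  rewrite JD -ler_pdivrMr//; set c := b y x - g y => h.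
  have {}h : m <= J x - c ^+ 2 / n y ^+ 2.
    rewrite (le_trans h)// le_eqVlt; apply/orP; left.
    by apply/eqP; field; rewrite -sqrf_eq0 gt_eqF.
  lra.
have par x y (e : R) : J x < m + e -> J y < m + e -> n (x - y) ^+ 2 < 4 * e.
  move=> Jx Jy; have := Jm ((2^-1)%:C *: (x + y)).
  move: Jx Jy; rewrite /J gZ gD -!bn !(bDl, bDr, bZl, bZr, bNl, bNr) (bC y x).
  by lra.
pose F := filter_from [set e : R | 0 < e] (fun e => [set x | J x < m + e]).
have FF : ProperFilter F.
  apply: filter_from_proper => [|e /= e0]; last first.
    have [_ [x _ <-] Jx] := inf_adherent e0 J_inf.
    by exists x.
  apply: filter_from_filter; first by exists 1; rewrite /= ltr01.
  move=> e d /= e0 d0; exists (Num.min e d); first by rewrite /= lt_min e0.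
  move=> x /= Jx; split=> /=; rewrite (lt_le_trans Jx)// lerD2l ge_min lexx//.
  by rewrite orbT.
have Fc : cauchy F.
  apply/cauchy_ballP => e e0.
  have [d d0 ed] : exists2 d : R, 0 < d & e = d%:C.
    by exists (complex.Re e); rewrite -?ltcR RRe_real// gtr0_real.
  have d40 : 0 < d ^+ 2 / 4 by rewrite divr_gt0// exprn_gt0.
  exists ([set x | J x < m + d ^+ 2 / 4], [set x | J x < m + d ^+ 2 / 4]).
    by split; exists (d ^+ 2 / 4).
  move=> [x y] [/= Jx Jy]; rewrite -ball_normE /ball_/= -rnormE ed ltcR.
  rewrite -(@ltr_pXn2r _ 2)// ?nnegrE ?(ltW d0)//.
  by rewrite (lt_le_trans (par _ _ _ Jx Jy))//; lra.
have Fz : F --> lim F by exact: cauchy_cvg Fc.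
set z := lim F in Fz.
exists z => y; apply/eqP; rewrite eq_sym -subr_eq0 -normr_le0.
apply/ler_addgt0Pr => e e0; rewrite add0r.
have [d d0 dy] : exists2 d, 0 < d & 2 * d * n y <= e.
  exists (e / (2 * (n y + 1))).
    by rewrite divr_gt0// mulr_gt0// ltr_wpDl.
  have n1 : 0 < n y + 1 by rewrite ltr_wpDl.
  rewrite [leLHS](_ : _ = e * (n y / (n y + 1))); last by field; rewrite gt_eqF.
  by rewrite ler_piMr ?ltW// ltr_pdivrMr// mul1r ltrDl.
have : \forall x \near F, `|z - x| < d%:C.
  have d0' : 0 < d%:C by rewrite ltcR.
  by have := Fz _ (nbhsx_ballx z _ d0'); rewrite -ball_normE.
have : \forall x \near F, J x < m + d ^+ 2.
  by exists (d ^+ 2) => //=; rewrite exprn_gt0.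
move=> FJ Fd; have [x [Jx zx]] := @filter_ex _ F _ _ (@filterI _ F _ _ _ FJ Fd).
have -> : b y z - complex.Re (f y) = (b y x - g y) + b y (z - x).
  by rewrite bDr bNr /g; ring.
rewrite (le_trans _ dy)// (le_trans (ler_normD _ _))//.
have -> : 2 * d * n y = d * n y + n y * d by ring.
rewrite lerD//.
  rewrite -(@ler_pXn2r _ 2)// ?nnegrE ?mulr_ge0 ?(ltW d0)//.
  by rewrite real_normK ?num_real// exprMn var.
by rewrite (le_trans (b_le _ _))// ler_wpM2l// -lecR rnormE ltW.
Qed.

Lemma riesz (f : {linear H -> R[i]}) (M : R) :
  (forall x, `|f x| <= M%:C * `|x|) -> exists z, forall x, f x = inner x z.
Proof.
move=> /riesz_re[z fz]; exists z => x; apply/eqP; rewrite eq_complex fz eqxx/=.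
have := fz ('i *: x); rewrite /re_inner linearZ/= innerZl.
case: (f x) (inner x z) => [u v] [u' v'] /=.
by rewrite !(mul0r, mul1r, sub0r) => /oppr_inj ->.
Qed.

Lemma cauchy_schwarz x y : `|inner x y| <= `|x| * `|y|.
Proof.
have [->|xy0] := eqVneq (inner x y) 0; first by rewrite normr0 mulr_ge0.
pose c := `|inner x y| / inner x y.
have c1 : `|c| = 1 by rewrite normf_div normr_id divff// normr_eq0.
have cxy : inner (c *: x) y = `|inner x y| by rewrite innerZl divfK.
have := b_le (c *: x) y; rewrite /re_inner cxy.
rewrite -lecR rmorphM/= !rnormE normrZ c1 mul1r; apply: le_trans.
by rewrite -[in leLHS]normr_RRe lecR ler_norm.
Qed.

End HilbertSpaceTheory.

Section Adjoint.
Variables (R : realType) (H : hilbertType R).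
Local Notation boundedOp := (boundedOp H).
Implicit Types (S T : boundedOp) (x y : H).

Definition is_adjoint T S := forall x y, inner (T x) y = inner x (S y).

Lemma is_adjoint_inj T S S' : is_adjoint T S -> is_adjoint T S' -> S = S'.
Proof.
move=> TS TS'; apply: boundedOp_ext => y; apply: inner_inj => z.
by rewrite -TS TS'.
Qed.

Lemma adjoint_ex T : exists S, is_adjoint T S.
Proof.
have TM (y : H) x : `|inner (T x) y| <= (opnorm T * rnorm y)%:C * `|x|.
  rewrite rmorphM/= rnormE (le_trans (cauchy_schwarz _ _))// mulrAC.
  by rewrite ler_wpM2r// opnormP.
have /choice[S TS] : forall y, exists z, forall x, inner (T x) y = inner x z.
  move=> y; have fl : linear (fun x => inner (T x) y).
    by move=> c u v; rewrite linearP innerDl innerZl.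
  pose f := HB.pack_for {linear H -> R[i]} (fun x => inner (T x) y)
    (GRing.isLinear.Build _ _ _ _ _ fl).
  exact: (@riesz _ _ f _ (TM y)).
suff SB : S \in @bounded_linear R H by exists (BoundedOp SB) => x y; exact: TS.
apply/asboolP; split=> [c x y|].
  apply: inner_inj => z.
  by rewrite -TS !innerDr !innerZr !TS.
exists (opnorm T) => y; have [Sy0|Sy0] := eqVneq (S y) 0.
  by rewrite Sy0 normr0 mulr_ge0// ler0c opnorm_ge0.
have Sy : 0 < `|S y| by rewrite normr_gt0.
rewrite -(ler_pM2l Sy) -expr2 -inner_norm -TS.
rewrite -[leLHS]ger0_norm; last by rewrite TS inner_norm exprn_ge0.
rewrite (le_trans (cauchy_schwarz _ _))// mulrA ler_wpM2r//.
by rewrite mulrC opnormP.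
Qed.

Definition adjoint T : boundedOp := projT1 (cid (adjoint_ex T)).

Lemma adjointP T x y : inner (T x) y = inner x (adjoint T y).
Proof. exact: projT2 (cid (adjoint_ex T)) x y. Qed.

End Adjoint.

Section ComplexConvergence.
Variable R : realType.

Lemma ball_Re (z w : R[i]) (e : R) :
  ball z e%:C w -> ball (complex.Re z) e (complex.Re w).
Proof.
rewrite -!ball_normE /ball_/= -raddfB => zw.
by rewrite -ltcR (le_lt_trans (normc_ge_Re _)).
Qed.

Lemma ball_Im (z w : R[i]) (e : R) :
  ball z e%:C w -> ball (complex.Im z) e (complex.Im w).
Proof.
have Im_le (u : R[i]) : `|complex.Im u|%:C <= `|u|.
  have := normc_ge_Re ('i * u); rewrite normrM.
  have -> : `|'i : R[i]| = 1.
    by rewrite normc_def/= expr0n/= add0r expr1n sqrtr1.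
  by rewrite mul1r; case: u => a b /=; rewrite mul0r mul1r sub0r normrN.
rewrite -!ball_normE /ball_/= -raddfB => zw.
by rewrite -ltcR (le_lt_trans (Im_le _)).
Qed.

Lemma cvg_Re (T : Type) (F : set_system T) (f : T -> R[i]) (z : R[i]) :
  Filter F -> f @ F --> z -> (fun t => complex.Re (f t)) @ F --> complex.Re z.
Proof.
move=> FF fz; apply/cvg_ballP => e e0.
have e0' : 0 < e%:C by rewrite ltcR.
move/cvg_ballP : fz => /(_ _ e0'); apply: filterS => t; exact: ball_Re.
Qed.

Lemma cvg_complex (T : Type) (F : set_system T) (f : T -> R[i]) (a b : R) :
  Filter F -> (fun t => complex.Re (f t)) @ F --> a ->
  (fun t => complex.Im (f t)) @ F --> b ->
  f @ F --> (a +i* b).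
Proof.
move=> FF fa fb; apply/cvgrPdist_lt => e e0.
have [d d0 ->] : exists2 d : R, 0 < d & e = d%:C.
  by exists (complex.Re e); rewrite -?ltcR RRe_real// gtr0_real.
have d20 : 0 < d / 2 by rewrite divr_gt0.
move/cvgrPdist_lt : fa => /(_ _ d20) fa.
move/cvgrPdist_lt : fb => /(_ _ d20) fb.
apply: filterS2 fa fb => t /=; case: (f t) => u v /= ua vb.
have -> : (a +i* b) - (u +i* v) = (a - u)%:C + 'i * (b - v)%:C.
  by rewrite [LHS]complexE.
rewrite (le_lt_trans (ler_normD _ _))// normrM.
have -> : `|'i : R[i]| = 1.
  by rewrite normc_def/= expr0n/= add0r expr1n sqrtr1.
by rewrite mul1r !normc_def/= !expr0n/= !addr0 !sqrtr_sqr -rmorphD ltcR; lra.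
Qed.

Lemma complex_complete (F : set_system R[i]) :
  ProperFilter F -> cauchy F -> cvg F.
Proof.
move=> FF /cauchy_ballP Fc.
have ReF : cvg ((@complex.Re R) @ F).
  apply: cauchy_cvg; apply/cauchy_ballP => e e0.
  have e0' : 0 < e%:C by rewrite ltcR.
  have [[A B] [/= FA FB] AB] := Fc _ e0'.
  exists ((@complex.Re R) @` A, (@complex.Re R) @` B) => /=.
    by split; [apply: filterS FA|apply: filterS FB] => z Az; exists z.
  move=> [_ _] [/= [u Au <-] [v Bv <-]] /=; apply: ball_Re.
  exact: (AB (u, v)).
have ImF : cvg ((@complex.Im R) @ F).
  apply: cauchy_cvg; apply/cauchy_ballP => e e0.
  have e0' : 0 < e%:C by rewrite ltcR.
  have [[A B] [/= FA FB] AB] := Fc _ e0'.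
  exists ((@complex.Im R) @` A, (@complex.Im R) @` B) => /=.
    by split; [apply: filterS FA|apply: filterS FB] => z Az; exists z.
  move=> [_ _] [/= [u Au <-] [v Bv <-]] /=; apply: ball_Im.
  exact: (AB (u, v)).
apply/cvg_ex; exists (lim ((@complex.Re R) @ F) +i* lim ((@complex.Im R) @ F)).
exact: (@cvg_complex _ F id).
Qed.

HB.instance Definition _ := Uniform_isComplete.Build R[i] complex_complete.

End ComplexConvergence.

Section PreHilbertNorm.
Variables (R : realType) (U : lmodType R[i]).
Variable form : {dot U for (@Num.conj R[i])}.
Local Notation "''[' u , v ]" := (form u v) : ring_scope.
Local Notation "''[' u ]" := '[u, u]%R : ring_scope.

Lemma form_cauchy_schwarz u v : `|'[u, v]| ^+ 2 <= '[u] * '[v].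
Proof.
have [->|v0] := eqVneq v 0; first by rewrite !linear0r normr0 expr0n/= mulr0.
have v_gt0 : 0 < '[v] by rewrite dnorm_gt0.
rewrite -subr_ge0 -(pmulr_rge0 _ v_gt0).
have -> : '[v] * ('[u] * '[v] - `|'[u, v]| ^+ 2) = '['[v] *: u - '[u, v] *: v].
  rewrite dnormB !dnormZ linearZl_LR linearZr_LR/= !normCK rmorphM/=.
  have -> : Num.conj '[v] = '[v] by apply/CrealP; rewrite gtr0_real.
  by rewrite rmorphM/= conjCK; ring.
exact: dnorm_ge0.
Qed.

Lemma form_triangle u v : sqrtC '[u + v] <= sqrtC '[u] + sqrtC '[v].
Proof.
rewrite -ler_sqr ?nnegrE ?addr_ge0 ?sqrtC_ge0 ?dnorm_ge0//.
rewrite sqrrD !sqrtCK dnormD/= addrAC lerD2r lerD2l.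
rewrite -sqrtCM ?nnegrE ?dnorm_ge0//.
apply: (@le_trans _ _ (`|'[u, v]| *+ 2)).
  rewrite (le_trans (real_ler_norm _))//.
    by apply/CrealP; rewrite rmorphD/= conjCK addrC.
  by rewrite (le_trans (ler_normD _ _))// norm_conjC.
rewrite lerMn2r/= -ler_sqr ?nnegrE ?sqrtC_ge0 ?mulr_ge0 ?dnorm_ge0//.
by rewrite sqrtCK form_cauchy_schwarz.
Qed.

End PreHilbertNorm.

Section Ell2.
Variable R : realType.
Implicit Types (x y z : nat -> R[i]).

Lemma normCE (c : R[i]) : `|c| = (Normc.normc c)%:C. Proof. by []. Qed.

Lemma normc_ge0 (c : R[i]) : 0 <= Normc.normc c.
Proof. by rewrite -ler0c; exact: (normr_ge0 c). Qed.

Lemma cvg_seriesC (u : nat -> R[i]) (v : nat -> R) :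
  (forall k, Normc.normc (u k) <= v k) -> cvgn (series v) -> cvgn (series u).
Proof.
move=> uv vc.
have bnd (f : nat -> R) : (forall k, `|f k| <= Normc.normc (u k)) ->
    cvgn (series f).
  move=> fu; apply: normed_cvg; apply: (series_le_cvg _ _ _ vc) => k.
  - by rewrite normr_ge0.
  - by rewrite (le_trans _ (uv k))// normc_ge0.
  - by rewrite (le_trans (fu k)).
have Rec : cvgn (series (fun k => complex.Re (u k))).
  by apply: bnd => k; rewrite -lecR; exact: normc_ge_Re.
have Imc : cvgn (series (fun k => complex.Im (u k))).
  apply: bnd => k; case: (u k) => a b /=.
  by rewrite -sqrtr_sqr ler_sqrt ?addr_ge0 ?sqr_ge0// lerDr sqr_ge0.
apply/cvg_ex; exists (limn (series (fun k => complex.Re (u k))) +i*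
                      limn (series (fun k => complex.Im (u k)))).
apply: cvg_complex.
- rewrite (_ : (fun t => _) = series (fun k => complex.Re (u k)))//.
  by apply/funext => n; rewrite !seriesEord/= raddf_sum.
- rewrite (_ : (fun t => _) = series (fun k => complex.Im (u k)))//.
  by apply/funext => n; rewrite !seriesEord/= raddf_sum.
Qed.

Lemma cvg_real_complex (u : nat -> R) (a : R) :
  u @ \oo --> a -> (fun n => (u n)%:C) @ \oo --> a%:C.
Proof. by move=> ua; apply: cvg_complex => //=; exact: cvg_cst. Qed.

Definition square_summable : {pred nat -> R[i]} :=
  [pred x : nat -> R[i] |
    `[< cvgn (series (fun k => Normc.normc (x k) ^+ 2)) >]].

Lemma square_summable_bounded x (M : R) :
  (forall n, series (fun k => Normc.normc (x k) ^+ 2) n <= M) ->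
  x \in square_summable.
Proof.
move=> xM; apply/asboolP; apply: nondecreasing_is_cvgn.
  by apply/nondecreasing_series => k _ _; rewrite sqr_ge0.
by exists M => _ [n _ <-].
Qed.

Lemma square_summable_submod_closed : submod_closed square_summable.
Proof.
split=> [|c x y /asboolP xs /asboolP ys].
  apply: (@square_summable_bounded _ 0) => n.
  by rewrite seriesEord/= big1// => k _; rewrite expr0n/= addr0 sqrtr0 expr0n.
apply/asboolP; pose v k := 2 * Normc.normc c ^+ 2 * Normc.normc (x k) ^+ 2 +
  2 * Normc.normc (y k) ^+ 2.
have vc : cvgn (series v).
  by apply: is_cvg_seriesD; exact: is_cvg_seriesZ.
apply: (series_le_cvg _ _ _ vc) => k.
- by rewrite sqr_ge0.
- rewrite /v; apply: addr_ge0;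
    by repeat (apply: mulr_ge0 || apply: ler0n || apply: normc_ge0).
rewrite /v -mulrA -exprMn -Normc.normcM -mulrDr.
set a := c * x k; rewrite !fctE/= -/a.
apply: (@le_trans _ _ ((Normc.normc a + Normc.normc (y k)) ^+ 2)).
  rewrite ler_pXn2r ?nnegrE ?addr_ge0 ?normc_ge0//.
  by rewrite -lecR rmorphD; exact: (ler_normD a (y k)).
have := sqr_ge0 (Normc.normc a - Normc.normc (y k)); nra.
Qed.

HB.instance Definition _ := GRing.isSubmodClosed.Build R[i] (nat -> R[i])
  square_summable square_summable_submod_closed.

Record ell2 := Ell2 { ell2_fun :> nat -> R[i];
                      ell2P : ell2_fun \in square_summable }.

HB.instance Definition _ := [isSub for ell2_fun].
HB.instance Definition _ := [Choice of ell2 by <:].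
HB.instance Definition _ := [SubChoice_isSubLmodule of ell2 by <:].

Definition ell2_inner (x y : ell2) : R[i] :=
  limn (series (fun k => x k * Num.conj (y k))).

Lemma ell2_inner_cvg (x y : ell2) :
  series (fun k => x k * Num.conj (y k)) @ \oo --> ell2_inner x y.
Proof.
have /asboolP xs := ell2P x; have /asboolP ys := ell2P y.
apply: cvg_seriesC (is_cvg_seriesD xs ys) => k.
rewrite Normc.normcM.
have -> : Normc.normc (Num.conj (y k)) = Normc.normc (y k).
  by have := norm_conjC (y k); rewrite !normCE => -[].
have := sqr_ge0 (Normc.normc (x k) - Normc.normc (y k)).
have := normc_ge0 (x k); have := normc_ge0 (y k); rewrite !fctE; nra.
Qed.

Lemma ell2_inner_linearl (y : ell2) :
  linear_for *%R (ell2_inner ^~ y).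
Proof.
move=> c x z; apply: cvg_lim => //.
rewrite (_ : series _ =
    (fun n => c * series (fun k => x k * Num.conj (y k)) n) +
   series (fun k => z k * Num.conj (y k))).
  by apply: cvgD; [apply: cvgMr|]; exact: ell2_inner_cvg.
apply/funext => n; rewrite fctE !seriesEord/= mulr_sumr -big_split/=.
by apply: eq_bigr => k _; rewrite mulrDl mulrA.
Qed.

Lemma ell2_innerC (x y : ell2) :
  ell2_inner x y = (-1) ^+ false * Num.conj (ell2_inner y x).
Proof.
rewrite expr0 mul1r; apply: cvg_lim => //.
have := @ell2_inner_cvg y x.
move=> /cvgrPdist_lt yx; apply/cvgrPdist_lt => e /yx; apply: filterS => n.
rewrite -norm_conjC rmorphB/= !seriesEord/= rmorph_sum/=.
by under eq_bigr do rewrite rmorphM/= conjCK mulrC.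
Qed.

Lemma ell2_inner_linearr (x : ell2) :
  linear_for (Num.conj \; *%R) (ell2_inner x).
Proof.
move=> c y z; rewrite ell2_innerC ell2_inner_linearl (ell2_innerC x y).
by rewrite (ell2_innerC x z) !expr0 !mul1r rmorphD rmorphM/= .
Qed.

Definition ell2_sqnorm (x : nat -> R[i]) : R :=
  limn (series (fun k => Normc.normc (x k) ^+ 2)).

Lemma ell2_innerE (x : ell2) : ell2_inner x x = (ell2_sqnorm x)%:C.
Proof.
apply: cvg_lim => //; have /asboolP xs := ell2P x.
have := cvg_real_complex xs; apply: cvg_trans; apply: near_eq_cvg.
apply: nearW => n; rewrite !seriesEord/= rmorph_sum/=.
by apply: eq_bigr => k _; rewrite -normCK rmorphXn.
Qed.

Lemma series_le_ell2_sqnorm (x : ell2) n :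
  series (fun k => Normc.normc (x k) ^+ 2) n <= ell2_sqnorm x.
Proof.
have /asboolP xs := ell2P x; apply: nondecreasing_cvgn_le => //.
by apply/nondecreasing_series => k _ _; rewrite sqr_ge0.
Qed.

Lemma ell2_coord (x : ell2) k : Normc.normc (x k) ^+ 2 <= ell2_sqnorm x.
Proof.
apply: le_trans (series_le_ell2_sqnorm x k.+1).
rewrite seriesEord/= big_ord_recr/= lerDr sumr_ge0// => i _.
by rewrite sqr_ge0.
Qed.

Lemma ell2_inner_gt0 (x : ell2) : x != 0 -> 0 < ell2_inner x x.
Proof.
move=> x0; rewrite ell2_innerE ltcR lt_def.
have s0 : 0 <= ell2_sqnorm x by rewrite (le_trans _ (ell2_coord x 0))// sqr_ge0.
rewrite s0 andbT; apply: contra x0 => /eqP x0; apply/eqP/val_inj/funext => k /=.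
have := ell2_coord x k; rewrite x0 => h.
have : Normc.normc (x k) ^+ 2 == 0 by rewrite eq_le h sqr_ge0.
by rewrite sqrf_eq0 => /eqP/Normc.eq0_normc.
Qed.

HB.instance Definition _ := bilinear_isBilinear.Build R[i] ell2 ell2 R[i]
  *%R (Num.conj \; *%R) ell2_inner (ell2_inner_linearl, ell2_inner_linearr).
HB.instance Definition _ := isHermitianSesquilinear.Build R[i] ell2
  false Num.conj ell2_inner ell2_innerC.
HB.instance Definition _ :=
  isDotProduct.Build R[i] ell2 ell2_inner ell2_inner_gt0.

End Ell2.

Section Ell2Hilbert.
Variable R : realType.
Local Notation ell2 := (ell2 R).
Local Notation inner2 := (@ell2_inner R : {dot ell2 for (@Num.conj R[i])}).

Definition ell2_norm (x : ell2) : R[i] := sqrtC (ell2_inner x x).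

Lemma ler_ell2_normD x y : ell2_norm (x + y) <= ell2_norm x + ell2_norm y.
Proof. exact: (form_triangle inner2). Qed.

Lemma ell2_normZ (c : R[i]) x : ell2_norm (c *: x) = `|c| * ell2_norm x.
Proof.
rewrite /ell2_norm (dnormZ inner2) sqrtCM ?nnegrE ?exprn_ge0//.
by rewrite sqrCK.
Qed.

Lemma ell2_norm_eq0 x : ell2_norm x = 0 -> x = 0.
Proof. by move/eqP; rewrite (sqrt_dnorm_eq0 inner2) => /eqP. Qed.

HB.instance Definition _ :=
  Lmodule_isNormed.Build R[i] ell2 ler_ell2_normD ell2_normZ ell2_norm_eq0.

Lemma ell2_inner_norm (x : ell2) : ell2_inner x x = `|x| ^+ 2.
Proof. by rewrite sqrtCK. Qed.

Lemma ell2_norm_ltE (x : ell2) (e : R) : 0 < e ->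
  (`|x| < e%:C) = (ell2_sqnorm x < e ^+ 2).
Proof.
move=> e0; rewrite -(@ltr_pXn2r _ 2)// ?nnegrE ?normr_ge0 ?ler0c ?ltW//.
by rewrite -ell2_inner_norm ell2_innerE -rmorphXn ltcR.
Qed.

Lemma ell2_coord_norm (x : ell2) k : `|x k| <= `|x|.
Proof.
rewrite -(@ler_pXn2r _ 2)// ?nnegrE ?normr_ge0//.
by rewrite -ell2_inner_norm ell2_innerE normCE -rmorphXn lecR ell2_coord.
Qed.

Lemma series_normcE (x : nat -> R[i]) n :
  (series (fun k => Normc.normc (x k) ^+ 2) n)%:C = \sum_(i < n) `|x i| ^+ 2.
Proof.
by rewrite seriesEord rmorph_sum; apply: eq_bigr => i _; rewrite rmorphXn.
Qed.

Lemma ell2_complete (F : set_system ell2) :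
  ProperFilter F -> cauchy F -> cvg F.
Proof.
move=> FF /cauchy_ballP Fc.
have coordF k : cvg ((fun x : ell2 => x k) @ F).
  apply: cauchy_cvg; apply/cauchy_ballP => e e0.
  have [[A B] [/= FA FB] AB] := Fc _ e0.
  exists ((fun x : ell2 => x k) @` A, (fun x : ell2 => x k) @` B) => /=.
    by split; [apply: filterS FA|apply: filterS FB] => z Az; exists z.
  move=> [_ _] [/= [u Au <-] [v Bv <-]] /=.
  have := AB (u, v) (conj Au Bv); rewrite -!ball_normE /ball_/=.
  by apply: le_lt_trans; exact: (ell2_coord_norm (u - v)).
pose z k : R[i] := lim ((fun x : ell2 => x k) @ F).
have Fz (d : R) : 0 < d -> F [set x : ell2 |
    forall n, series (fun k => Normc.normc (x k - z k) ^+ 2) n <= d ^+ 2].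
  move=> d0; have d0' : 0 < d%:C by rewrite ltcR.
  have [[A B] [/= FA FB] AB] := Fc _ d0'.
  apply: filterS FA => x Ax n.
  pose f (y : ell2) : R[i] := \sum_(i < n) `|x i - y i| ^+ 2.
  have fz : f y @[y --> F] --> \sum_(i < n) `|x i - z i| ^+ 2.
    apply: cvg_big => [|i _]; first exact: add_continuous.
    rewrite expr2; apply: cvgM;
      by apply: cvg_norm; apply: cvgB; [exact: cvg_cst|exact: coordF].
  have -> : series (fun k => Normc.normc (x k - z k) ^+ 2) n =
      complex.Re (\sum_(i < n) `|x i - z i| ^+ 2).
    by rewrite -(series_normcE (fun k => x k - z k)).
  apply: (@closed_cvg _ _ F _ (fun y => complex.Re (f y))
    [set t | t <= d ^+ 2]).
  - exact: closed_le.
  - apply: filterS FB => y By /=.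
    have := AB (x, y) (conj Ax By); rewrite -ball_normE /ball_/=.
    rewrite ell2_norm_ltE// => /ltW; apply: le_trans.
    apply: le_trans (series_le_ell2_sqnorm (x - y) n).
    by rewrite /f -(series_normcE (fun k => x k - y k)).
  - exact: cvg_Re.
have /filter_ex[x0 x0z] := Fz 1 ltr01.
have zs : z \in @square_summable R.
  have zx : (x0 : nat -> R[i]) - z \in @square_summable R.
    exact: square_summable_bounded x0z.
  rewrite (_ : z = (x0 : nat -> R[i]) - ((x0 : nat -> R[i]) - z)).
    by rewrite rpredB// ell2P.
  by rewrite subKr.
apply/cvg_ex; exists (Ell2 zs); apply/cvg_ballP => e e0.
have [d d0 ->] : exists2 d : R, 0 < d & e = d%:C.
  by exists (complex.Re e); rewrite -?ltcR RRe_real// gtr0_real.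
have d20 : 0 < d / 2 by rewrite divr_gt0.
apply: filterS (Fz _ d20) => x xz.
rewrite -ball_normE /ball_/= distrC ell2_norm_ltE//.
apply: (@le_lt_trans _ _ ((d / 2) ^+ 2)); last first.
  by rewrite ltr_pXn2r ?nnegrE ?ltW//; lra.
have /asboolP xzs := ell2P (x - Ell2 zs).
by apply: limr_le => //; apply: nearW => n; exact: xz.
Qed.

HB.instance Definition _ := Uniform_isComplete.Build ell2 ell2_complete.
HB.instance Definition _ :=
  CompleteNormedModule_isHilbert.Build R ell2 ell2_inner_norm.

End Ell2Hilbert.

Section CStarConvexity.
Variables (R : realType) (H : hilbertType R).
Local Notation boundedOp := (boundedOp H).

Definition compact_op : set boundedOp :=
  [set T | precompact (T @` [set x : H | `|x| <= 1])].

Definition self_adjoint : set boundedOp := [set T | adjoint T = T].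

Definition cstar_subalgebra (A : set boundedOp) : Prop :=
  [/\ closed A, A 0,
      (forall (c : R[i]) S T, A S -> A T -> A (c *: S + T)),
      (forall S T, A S -> A T -> A (S * T))
    & (forall T, A T -> A (adjoint T))].

Definition cstar_generated (S : set boundedOp) : set boundedOp :=
  smallest cstar_subalgebra S.

(* If H is finite-dimensional, then every operator is compact and this is
   K(H) = B(H) itself, which is already unital. *)
Definition compact_unitization : set boundedOp :=
  cstar_generated (compact_op `|` [set 1]).

Lemma cstar_subalgebraT : cstar_subalgebra setT.
Proof. by split=> //; exact: closedT. Qed.

Lemma cstar_generated_subalgebra (S : set boundedOp) :
  cstar_subalgebra (cstar_generated S).
Proof.
split=> [||c T U AT AU|T U AT AU|T AT].
- by apply: closed_bigI => A [[]].
- by move=> A [[]].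
- by move=> A AS; have [[_ _ + _ _] _] := AS; apply; [exact: AT|exact: AU].
- by move=> A AS; have [[_ _ _ + _] _] := AS; apply; [exact: AT|exact: AU].
- by move=> A AS; have [[_ _ _ _ +] _] := AS; apply; exact: AT.
Qed.

Lemma compact_unitization1 : compact_unitization 1.
Proof. by apply: sub_gen_smallest; right. Qed.

(* In the definitions below, A is the unital C*-algebra in which the notions
   are taken: a C*-subalgebra of B(H) that contains the identity. *)
Definition cstar_convex (A X : set boundedOp) : Prop :=
  X `<=` A /\
  forall (n : nat) (x a : 'I_n -> boundedOp), (0 < n)%N ->
    (forall i, X (x i)) -> (forall i, A (a i)) ->
    \sum_(i < n) adjoint (a i) * a i = 1 ->
    X (\sum_(i < n) adjoint (a i) * x i * a i).

Definition MCL (A S : set boundedOp) : set boundedOp :=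
  smallest [set X | closed X /\ cstar_convex A X] S.

Definition cstar_polyhedron (A : set boundedOp) (I : Type)
    (a : I -> boundedOp) : Prop :=
  (forall i, A (a i)) /\ forall i, ~ MCL A (a @` [set~ i]) (a i).

Definition cstar0_polyhedron (A : set boundedOp) (I : Type)
    (a : I -> boundedOp) : Prop :=
  (forall i, A (a i)) /\ forall i, ~ MCL A (a @` [set~ i] `|` [set 0]) (a i).

End CStarConvexity.

Arguments compact_op {R H}.
Arguments self_adjoint {R H}.
Arguments compact_unitization {R} H.

(* Main.v *)
Require Import Defs.
From mathcomp Require Import all_boot all_order all_algebra.
From mathcomp Require Import ring lra zify complex spectral.
From mathcomp Require Import boolp classical_sets functions cardinality reals.
From mathcomp Require Import topology normedtype sequences trigo.

(* Pigeonhole. For each n, every operator a_i gets a code in a countable set such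
   that equal codes allow a_i to be approximated within O(1/n) by an operator
   sum_s c_s^* a_j c_s with sum_s c_s^* c_s = 1. As the family is uncountable,
   some i admits for each n a j != i with the same code, so a_i is in the hull
   of the other operators.

   Compact operators: a_i is close to P a_i P for a finite-rank projection P,
   and its code is a rounding of the matrix of P a_i P. If j has the same code,
   a partial isometry c with c^* c = P makes c^* a_j c close to a_i, and the
   remaining weight 1 - P is put on the operator 0. In B(l_2) the operator 0 is
   in the hull of any compact operator a, as a limit of s^* a s for powers s of
   the shift.

   Self-adjoint operators on l_2: in a suitable orthonormal basis T is block
   tridiagonal, and a slowly varying partition of unity W_0^2 + W_1^2 = 1 gives
   T ~ W_0 T W_0 + W_1 T W_1 where the compression of T to the range of each W_s
   is a direct sum of finite blocks, hence diagonal in an orthonormal basis z_s.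
   The code counts, for each s, the eigenvalues in each cell of a grid, with
   values in {0, 1, ..., infinity}. If two operators have the same code, an
   injection between the bases z_s that nearly preserves the eigenvalues yields
   an isometry S_s, and c_s = S_s W_s. *)

Import Order.TTheory GRing.Theory Num.Theory.
Import numFieldNormedType.Exports.

Local Open Scope classical_set_scope.

Set Implicit Arguments.
Unset Strict Implicit.
Unset Printing Implicit Defensive.

Local Open Scope ring_scope.
Local Open Scope complex_scope.

(* If every [i] had a level [n i] at which its code is unique, then
   [i |-> (n i, code (n i) i)] would embed [I] in a countable type. *)
Lemma uncountable_twins (I : Type) (T : countType) (code : nat -> I -> T) :
  ~ countable [set: I] ->
  exists i, forall n, exists2 j, j <> i & code n j = code n i.
Proof.
move=> Iunc; apply: contrapT => h; apply: Iunc.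
have /choice[n nP] : forall i, exists n, forall j, code n j = code n i -> j = i.
  move=> i; apply: contrapT => hi; apply: h; exists i => n.
  apply: contrapT => hn; apply: hi; exists n => j cj.
  by apply: contrapT => ji; apply: hn; exists j.
pose F i : nat * T := (n i, code (n i) i).
have Finj : injective F.
  by move=> i j [nij cij]; apply: nP; rewrite -cij nij.
apply/countable_injP; exists (pickle \o F) => i j _ _ /= /(pcan_inj pickleK).
exact: Finj.
Qed.

(** * Inner product identities and operator norm bounds from forms *)

Section HilbertBasics.
Variables (R : realType) (H : hilbertType R).
Local Notation boundedOp := (boundedOp H).
Local Notation C := R[i].
Implicit Types (x y z : H) (S T : boundedOp).

Lemma inner0r x : inner x 0 = 0.
Proof. by rewrite innerC inner0l conjc0. Qed.

Lemma innerNr x y : inner x (- y) = - inner x y.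
Proof. by rewrite innerC innerNl rmorphN/= -innerC. Qed.

Lemma innerBl x y z : inner (x - y) z = inner x z - inner y z.
Proof. by rewrite innerDl innerNl. Qed.

Lemma innerBr x y z : inner x (y - z) = inner x y - inner x z.
Proof. by rewrite innerDr innerNr. Qed.

Lemma inner_suml (I : Type) (r : seq I) (P : pred I) (F : I -> H) y :
  inner (\sum_(i <- r | P i) F i) y = \sum_(i <- r | P i) inner (F i) y.
Proof.
by apply: (big_morph (fun x => inner x y)) => [? ?|]; rewrite ?innerDl ?inner0l.
Qed.

Lemma inner_sumr (I : Type) (r : seq I) (P : pred I) (F : I -> H) x :
  inner x (\sum_(i <- r | P i) F i) = \sum_(i <- r | P i) inner x (F i).
Proof. by apply: (big_morph (inner x)) => [? ?|]; rewrite ?innerDr ?inner0r. Qed.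

Lemma boundedOp_sumE (I : Type) (r : seq I) (P : pred I) (F : I -> boundedOp) x :
  (\sum_(i <- r | P i) F i) x = \sum_(i <- r | P i) F i x.
Proof. by apply: (big_morph (fun T : boundedOp => T x)). Qed.

Lemma opD T x y : T (x + y) = T x + T y. Proof. exact: linearD. Qed.
Lemma opN T x : T (- x) = - T x. Proof. exact: linearN. Qed.
Lemma opB T x y : T (x - y) = T x - T y. Proof. exact: linearB. Qed.
Lemma opZ T (k : C) x : T (k *: x) = k *: T x. Proof. exact: linearZ. Qed.
Lemma op0 T : T 0 = 0. Proof. exact: linear0. Qed.
Lemma op_sum T (I : Type) (r : seq I) (P : pred I) (F : I -> H) :
  T (\sum_(i <- r | P i) F i) = \sum_(i <- r | P i) T (F i).
Proof. exact: linear_sum. Qed.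

Lemma inner_adjointl T x y : inner (adjoint T x) y = inner x (T y).
Proof. by rewrite innerC -adjointP -innerC. Qed.

Lemma inner_conj T S x y : inner ((adjoint T * S * T) x) y = inner (S (T x)) (T y).
Proof. by rewrite !boundedOp_mulE inner_adjointl. Qed.

Lemma boundedOp_inner_ext S T :
  (forall x y, inner (S x) y = inner (T x) y) -> S = T.
Proof.
move=> ST; apply: boundedOp_ext => x; apply: inner_inj => z.
by rewrite innerC ST -innerC.
Qed.

Lemma opnorm_le_form T (M : C) : 0 <= M ->
  (forall x y, `|inner (T x) y| <= M * `|x| * `|y|) -> `|T| <= M.
Proof.
move=> M0 TM; rewrite boundedOp_normE.
have -> : M = (complex.Re M)%:C by rewrite RRe_real ?ger0_real.
rewrite lecR opnorm_le//; first by rewrite -ler0c RRe_real ?ger0_real.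
move=> x; rewrite RRe_real ?ger0_real//.
have [->|Tx0] := eqVneq (T x) 0; first by rewrite normr0 mulr_ge0.
have Tx : 0 < `|T x| by rewrite normr_gt0.
rewrite -(ler_pM2r Tx) -expr2 -inner_norm (le_trans _ (TM x (T x)))//.
by rewrite inner_norm ger0_norm ?exprn_ge0.
Qed.

Lemma op_polarization T x y : 4 * inner (T x) y =
  inner (T (x + y)) (x + y) - inner (T (x - y)) (x - y)
  + 'i * inner (T (x + 'i *: y)) (x + 'i *: y)
  - 'i * inner (T (x - 'i *: y)) (x - 'i *: y).
Proof.
have ii : 'i * 'i = -1 :> C.
  apply/eqP; rewrite eq_complex/=.
  by rewrite !(mul0r, mulr0, mul1r, oppr0, addr0, sub0r) !eqxx.
have ci : Num.conj ('i : C) = - 'i.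
  by apply/eqP; rewrite eq_complex/= oppr0 !eqxx.
rewrite !(opD, opN, opZ).
rewrite !(innerDl, innerDr, innerNl, innerNr, innerZl, innerZr) ci.
set a := inner (T x) y; set b := inner (T x) x; set c := inner (T y) x; set d := inner (T y) y.
(* [ring] does not know ['i * 'i = -1], so the discrepancy is isolated as a multiple of
   ['i * 'i + 1]. *)
rewrite [RHS](_ : _ = 4 * a + ('i * 'i + 1) * (2 * c - 2 * a)); last by ring.
by rewrite ii addNr mul0r addr0.
Qed.

Lemma norm_i : `|'i : C| = 1.
Proof. by rewrite normc_def/= expr0n/= add0r expr1n sqrtr1. Qed.

Lemma parallelogram x y :
  `|x + y| ^+ 2 + `|x - y| ^+ 2 = 2 * `|x| ^+ 2 + 2 * `|y| ^+ 2.
Proof.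
rewrite -!inner_norm !(innerDl, innerDr, innerNl, innerNr); ring.
Qed.

(** Polarization writes [4 <T x, y>] as two differences of quadratic values. For unit vectors the
    parallelogram law bounds each difference by [4 M], whence the factor 2. *)
Lemma opnorm_le_quad T (M : C) : 0 <= M ->
  (forall x, `|inner (T x) x| <= M * `|x| ^+ 2) -> `|T| <= 2 * M.
Proof.
move=> M0 TM.
suff h x y : `|x| = 1 -> `|y| = 1 -> `|inner (T x) y| <= 2 * M.
  apply: opnorm_le_form => [|x y]; first by rewrite mulr_ge0.
  have [->|x0] := eqVneq x 0; first by rewrite linear0 inner0l !normr0 mulr0 mul0r.
  have [->|y0] := eqVneq y 0; first by rewrite inner0r !normr0 mulr0.
  have := h (`|x|^-1 *: x) (`|y|^-1 *: y).
  rewrite !normfZV// opZ innerZl innerZr !normrM norm_conjC !normfV !normr_id.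
  move=> /(_ erefl erefl).
  rewrite mulrCA ler_pdivrMl ?normr_gt0// ler_pdivrMl ?normr_gt0//.
  by rewrite [leRHS](_ : _ = 2 * M * `|x| * `|y|)//; ring.
move=> x1 y1; have Q u v : `|u| = 1 -> `|v| = 1 ->
    `|inner (T (u + v)) (u + v) - inner (T (u - v)) (u - v)| <= 4 * M.
  move=> u1 v1; rewrite (le_trans (ler_normB _ _))//.
  rewrite (le_trans (lerD (TM _) (TM _)))// -mulrDr parallelogram u1 v1 expr1n.
  by rewrite mulr1 -natrD mulrC.
rewrite -(ler_pM2l (ltr0Sn _ 3)) -[X in X * _ <= _](normr_nat C 4) -normrM.
rewrite op_polarization -addrA -mulrBr (le_trans (ler_normD _ _))//.
have -> : 4 * (2 * M) = 4 * M + 4 * M by ring.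
by rewrite lerD// ?Q// normrM norm_i mul1r Q// normrZ norm_i mul1r.
Qed.

End HilbertBasics.

(** * Orthonormal systems, Gram-Schmidt, and operators defined by series *)

Section OrthoSystems.
Variables (R : realType) (H : hilbertType R).
Local Notation boundedOp := (boundedOp H).
Local Notation C := R[i].
Implicit Types (x y : H) (g z : nat -> H) (T : boundedOp).

(* Zero vectors are allowed, so that Gram-Schmidt never has to skip a vector. *)
Definition orthosys g :=
  forall i j, inner (g i) (g j) = ((i == j) && (g i != 0))%:R.

Lemma orthosys_norm g i : orthosys g -> `|g i| ^+ 2 = (g i != 0)%:R.
Proof. by move=> go; rewrite -inner_norm go eqxx. Qed.

Lemma diag_form T (I : eqType) (r : seq I) (z : I -> H) (c d : I -> C) :
  uniq r -> (forall i j, i != j -> inner (T (z i)) (z j) = 0) ->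
  inner (T (\sum_(i <- r) c i *: z i)) (\sum_(j <- r) d j *: z j) =
  \sum_(i <- r) c i * Num.conj (d i) * inner (T (z i)) (z i).
Proof.
move=> ur zT; rewrite op_sum inner_suml [LHS]big_seq [RHS]big_seq.
apply: eq_bigr => i ir; rewrite opZ inner_sumr (bigD1_seq i)//=.
rewrite big1 ?addr0 => [|j ji]; first by rewrite innerZl innerZr mulrA.
by rewrite innerZl innerZr zT 1?eq_sym// !mulr0.
Qed.

Lemma orthosys_sqnorm g (r : seq nat) (c : nat -> C) : orthosys g -> uniq r ->
  `|\sum_(i <- r) c i *: g i| ^+ 2 = \sum_(i <- r) `|c i| ^+ 2 * (g i != 0)%:R.
Proof.
move=> go ur; rewrite -inner_norm.
rewrite -[X in inner X _](boundedOp_oneE (\sum_(i <- r) c i *: g i)).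
rewrite diag_form// => [|i j ij]; last by rewrite boundedOp_oneE go (negPf ij).
by apply: eq_bigr => i _; rewrite boundedOp_oneE go eqxx normCK.
Qed.

Lemma orthosys_coef g n (c : nat -> C) i : orthosys g ->
  inner (\sum_(0 <= j < n) c j *: g j) (g i) = c i * ((i < n)%N && (g i != 0))%:R.
Proof.
move=> go; rewrite inner_suml; have [ni|ni] := ltnP i n.
  rewrite (bigD1_seq i) ?mem_index_iota ?iota_uniq//= innerZl go eqxx.
  by rewrite big1 ?addr0// => j ji; rewrite innerZl go (negPf ji) mulr0.
rewrite mulr0 big_nat big1// => j /andP[_ jn]; rewrite innerZl go.
by rewrite (_ : (j == i) = false) ?mulr0//; apply: ltn_eqF; exact: leq_trans ni.
Qed.

(* [F] may choose the next vector in terms of the orthonormal vectors already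
   constructed; this is what makes Krylov-type bases available. *)
Lemma gram_schmidt (F : seq H -> H) : exists g, orthosys g /\
  forall n, F (mkseq g n) =
    \sum_(0 <= i < n.+1) inner (F (mkseq g n)) (g i) *: g i.
Proof.
pose w s := F s - \sum_(u <- s) inner (F s) u *: u.
pose next s := `|w s|^-1 *: w s.
pose gl := fix gl n := if n is n'.+1 then rcons (gl n') (next (gl n')) else [::].
pose g n := next (gl n).
have glE n : gl n = mkseq g n by elim: n => //= n IH; rewrite mkseqS -IH.
have gE n : g n = next (mkseq g n) by rewrite -glE.
have wE n : w (mkseq g n) = F (mkseq g n) -
    \sum_(0 <= i < n) inner (F (mkseq g n)) (g i) *: g i.
  by rewrite /w {2}/mkseq big_map /index_iota subn0.
have gw n : (g n != 0) = (w (mkseq g n) != 0).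
  by rewrite gE /next scaler_eq0 invr_eq0 normr_eq0 orbb.
have gn n : inner (g n) (g n) = (g n != 0)%:R.
  rewrite gw gE /next inner_norm normrZ normfV normr_id exprMn.
  have [->|w0] := eqVneq; first by rewrite normr0 expr0n mulr0.
  by rewrite -exprMn mulVf ?normr_eq0// expr1n.
have go n : forall i j, (i < n)%N -> (j < n)%N ->
    inner (g i) (g j) = ((i == j) && (g i != 0))%:R.
  elim: n => // n IH.
  have new j : (j < n)%N -> inner (g n) (g j) = 0.
    move=> jn; rewrite gE /next innerZl; set k := _^-1.
    rewrite wE innerBl inner_suml.
    rewrite (bigD1_seq j) ?mem_index_iota ?iota_uniq//= innerZl IH// eqxx.
    rewrite big_nat_cond big1 ?addr0 => [|i /andP[/andP[_ i_n] ij]]; last first.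
      by rewrite innerZl IH// (negPf ij) mulr0.
    have [->|gj] := eqVneq (g j) 0; first by rewrite inner0r mul0r subrr mulr0.
    by rewrite mulr1 subrr mulr0.
  move=> i j; rewrite !ltnS leq_eqVlt => /orP[/eqP->|i_n].
    rewrite leq_eqVlt => /orP[/eqP->|jn]; first by rewrite gn eqxx.
    by rewrite new// (gtn_eqF jn).
  rewrite leq_eqVlt => /orP[/eqP->|jn]; last exact: IH.
  by rewrite innerC new// conjc0 (ltn_eqF i_n).
exists g; split=> [i j|n].
  by apply: (go (maxn i j).+1); rewrite ltnS ?leq_maxl ?leq_maxr.
set v := F _; rewrite big_nat_recr//=.
have vE : v = \sum_(0 <= i < n) inner v (g i) *: g i + w (mkseq g n).
  by rewrite wE addrC subrK.
rewrite {1}vE; congr (_ + _).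
have wg : w (mkseq g n) = `|w (mkseq g n)| *: g n.
  rewrite gE /next scalerA; have [->|w0] := eqVneq (w (mkseq g n)) 0.
    by rewrite normr0 mul0r scale0r.
  by rewrite mulfV ?normr_eq0// scale1r.
rewrite {1}wg; have [->|g0] := eqVneq (g n) 0; first by rewrite !scaler0.
congr (_ *: _); rewrite vE innerDl inner_suml big_nat big1 ?add0r.
  by rewrite {2}wg innerZl gn g0 mulr1.
move=> i /andP[_ i_n]; rewrite innerZl (go n.+1)// ?(ltnW i_n)//; last first.
  by rewrite ltnS ltnW.
by rewrite (ltn_eqF i_n) mulr0.
Qed.

(** The Bessel-type bound on [f] makes [sum_i <x, f_i> z_i] converge to a vector of norm at most
    [|x|]. The value is recorded only where the series is a finite sum; on a dense set this is all
    that is used. *)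
Lemma synthesis f z : orthosys z ->
  (forall n x, \sum_(0 <= i < n) `|inner x (f i)| ^+ 2 <= `|x| ^+ 2) ->
  exists c : boundedOp, forall x n, (forall i, (n <= i)%N -> inner x (f i) = 0) ->
    c x = \sum_(0 <= i < n) inner x (f i) *: z i.
Proof.
move=> zo fB; pose u x i := inner x (f i) *: z i.
have uB x m n : `|\sum_(m <= i < n) u x i| ^+ 2 <=
    \sum_(m <= i < n) `|inner x (f i)| ^+ 2.
  rewrite orthosys_sqnorm ?iota_uniq// ler_sum// => i _.
  by rewrite ler_piMr ?exprn_ge0//; case: (z i != 0).
pose a x i := Normc.normc (inner x (f i)) ^+ 2.
have aE x m n : \sum_(m <= i < n) `|inner x (f i)| ^+ 2 =
    (\sum_(m <= i < n) a x i)%:C.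
  by rewrite rmorph_sum/=; apply: eq_bigr => i _; rewrite normCE rmorphXn.
have ac x : cvgn (series (a x)).
  apply: nondecreasing_is_cvgn.
    by apply/nondecreasing_series => k _ _; rewrite sqr_ge0.
  exists (rnorm x ^+ 2) => _ [n _ <-].
  by rewrite -lecR /= -aE rmorphXn/= rnormE fB.
have uc x : cvgn (series (u x)).
  apply: cauchy_cvg; apply/cauchy_seriesP => e e0.
  have [d d0 ed] : exists2 d : R, 0 < d & e = d%:C.
    by exists (complex.Re e); rewrite -?ltcR RRe_real// gtr0_real.
  have /cauchy_cvgP/cauchy_seriesP/(_ (d ^+ 2)) := ac x.
  rewrite exprn_gt0// => /(_ isT); apply: filterS => -[m n]/= mn.
  rewrite -(@ltr_pXn2r _ 2)// ?nnegrE ?(ltW e0)// (le_lt_trans (uB _ _ _))//.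
  by rewrite aE ed -rmorphXn ltcR (le_lt_trans (ler_norm _)).
pose c x := limn (series (u x)).
have cl : linear c.
  move=> k x y; apply: cvg_lim => //.
  rewrite (_ : series _ = (k \*: series (u x)) + series (u y)).
    by apply: cvgD; [apply: cvgZr|]; exact: uc.
  apply/funext => n; rewrite !fctE /series/= scaler_sumr -big_split/=.
  by apply: eq_bigr => i _; rewrite /u innerDl innerZl scalerDl scalerA.
have cB x : `|c x| <= `|x|.
  apply/ler_addgt0Pr => e e0.
  have /cvgrPdist_lt/(_ e e0)[n _ /(_ n (leqnn n))/= cn] := uc x.
  rewrite -[c x](subrK (series (u x) n)) (le_trans (ler_normD _ _))// addrC.
  rewrite lerD ?(ltW cn)// -(@ler_pXn2r _ 2)// ?nnegrE//.
  exact: le_trans (uB _ _ _) (fB _ _).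
have cP : c \in @bounded_linear R H.
  by apply/asboolP; split=> //; exists 1 => x; rewrite mul1r.
exists (BoundedOp cP) => x n xn; apply: cvg_lim => //.
apply: cvg_near_cst; exists n => // m /= nm.
rewrite /series/= (@big_cat_nat _ _ _ n)//=.
rewrite [Y in _ + Y](_ : _ = 0) ?addr0// big_nat big1// => i /andP[ni _].
by rewrite /u xn// scale0r.
Qed.

End OrthoSystems.

(** * Closed C*-convex hulls *)

Section StarConvexHull.
Variables (R : realType) (H : hilbertType R).
Local Notation boundedOp := (boundedOp H).
Local Notation C := R[i].
Implicit Types (x y : H) (S T : boundedOp) (A X : set boundedOp).

Lemma closed_approx X T : closed X ->
  (forall e : R, 0 < e -> exists2 S, X S & `|T - S| <= e%:C) -> X T.
Proof.
move=> + XT => /closure_id -> B /nbhs_normP[e /= e0 eB].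
have [d d0 ed] : exists2 d : R, 0 < d & e = d%:C.
  by exists (complex.Re e); rewrite -?ltcR RRe_real// gtr0_real.
have d20 : 0 < d / 2 by rewrite divr_gt0.
have [S XS TS] := XT _ d20; exists S; split=> //; apply: eB => /=.
by rewrite (le_lt_trans TS)// ed ltcR ltr_pdivrMr// ltr_pMr// ltrDl.
Qed.

Lemma MCL_sub A X : X `<=` MCL A X.
Proof. exact: sub_gen_smallest. Qed.

Lemma MCL_closed A X : closed (MCL A X).
Proof. by apply: closed_bigI => B [[]]. Qed.

(** All C*-convex combinations formed below have two terms. *)
Lemma MCL_comb A X S T a b : A a -> A b -> MCL A X S -> MCL A X T ->
  adjoint a * a + adjoint b * b = 1 ->
  MCL A X (adjoint a * S * a + adjoint b * T * b).
Proof.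
move=> Aa Ab XS XT ab1 B BP; have [XSB XTB] := (XS _ BP, XT _ BP).
have [[_ [_ Bconv]] _] := BP.
pose x (i : 'I_2) := if val i == 0%N then S else T.
pose c (i : 'I_2) := if val i == 0%N then a else b.
have -> : adjoint a * S * a + adjoint b * T * b =
    \sum_(i < 2) adjoint (c i) * x i * c i by rewrite !big_ord_recl big_ord0 addr0.
apply: Bconv => // [i|i|]; last by rewrite !big_ord_recl big_ord0 addr0.
- by rewrite /x; case: ifP.
- by rewrite /c; case: ifP.
Qed.

Lemma MCL_mono A X Y : X `<=` Y -> MCL A X `<=` MCL A Y.
Proof. by move=> XY T XT B [BP YB]; apply: XT; split=> // S /XY/YB. Qed.

End StarConvexHull.

(** * Finite-rank operators and projections *)

Section FiniteRank.
Variables (R : realType) (H : hilbertType R).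
Local Notation boundedOp := (boundedOp H).
Local Notation C := R[i].
Implicit Types (x y u v : H) (g h : nat -> H) (S T : boundedOp).

Lemma rank_one_bounded_linear u v :
  (fun x => inner x u *: v) \in @bounded_linear R H.
Proof.
apply/asboolP; split=> [c x y|]; first by rewrite innerDl innerZl scalerDl scalerA.
exists (rnorm u * rnorm v) => x; rewrite normrZ rmorphM/= !rnormE.
by rewrite mulrAC ler_wpM2r// (le_trans (cauchy_schwarz _ _))// mulrC.
Qed.

Definition rank_one u v : boundedOp := BoundedOp (rank_one_bounded_linear u v).

Definition finite_rank g h n : boundedOp :=
  \sum_(0 <= i < n) rank_one (g i) (h i).

Lemma finite_rankE g h n x :
  finite_rank g h n x = \sum_(0 <= i < n) inner x (g i) *: h i.
Proof. by rewrite boundedOp_sumE. Qed.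

(** The real and imaginary parts of [<x, u>] lie in [[-|u|, |u|]], so the image of the unit ball is
    contained in a continuous image of a compact square. *)
Lemma rank_one_compact u v : compact_op (rank_one u v).
Proof.
pose M := rnorm u.
pose f (p : R * R) : H := (p.1)%:C *: v + (p.2)%:C *: ('i *: v).
have fc : continuous f.
  have cC : continuous (fun t : R => t%:C).
    move=> t; apply: (@cvg_complex _ _ (nbhs t) (fun t => t%:C) t 0) => /=.
      exact: cvg_id.
    exact: cvg_cst.
  move=> p; apply: cvgD; apply: cvgZ; try exact: cvg_cst.
  - by apply: (cvg_comp _ _ cvg_fst); exact: cC.
  - by apply: (cvg_comp _ _ cvg_snd); exact: cC.
rewrite /compact_op /=.
apply: (@precompact_subset _ _ (f @` (`[- M, M]%classic `*` `[- M, M]%classic))).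
  move=> _ [x /= x1 <-].
  have xu : `|inner x u| <= M%:C.
    rewrite rnormE (le_trans (cauchy_schwarz _ _))// -[leRHS]mul1r.
    by rewrite ler_wpM2r.
  exists (complex.Re (inner x u), complex.Im (inner x u)).
    have Re_le := le_trans (normc_ge_Re (inner x u)) xu.
    have Im_le : `|complex.Im (inner x u)|%:C <= M%:C.
      apply: le_trans xu; case: (inner x u) => a b; rewrite lecR /=.
      by rewrite -sqrtr_sqr ler_sqrt ?addr_ge0 ?sqr_ge0// lerDr sqr_ge0.
    by move: Re_le Im_le; rewrite !lecR !ler_norml /= !in_itv.
  by rewrite /f /= scalerA -scalerDl mulrC -complexE.
apply: compact_precompact; first exact: norm_hausdorff.
apply: continuous_compact; last by apply: compact_setX; exact: segment_compact.
exact: continuous_subspaceT.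
Qed.

Lemma finite_rank_unitization g h n : compact_unitization H (finite_rank g h n).
Proof.
have [Acl A0 AD AM AA] : cstar_subalgebra (compact_unitization H).
  exact: cstar_generated_subalgebra.
rewrite /finite_rank; elim: n => [|n AS]; first by rewrite big_geq.
rewrite big_nat_recr//= -[X in X + _]scale1r; refine (AD _ _ _ AS _).
by apply: sub_gen_smallest; left; exact: rank_one_compact.
Qed.

Lemma compl_unitization T : compact_unitization H T -> compact_unitization H (1 - T).
Proof.
have [Acl A0 AD AM AA] : cstar_subalgebra (compact_unitization H).
  exact: cstar_generated_subalgebra.
move=> AT; rewrite addrC -scaleN1r; apply: AD => //.
by apply: sub_gen_smallest; right.
Qed.

Local Notation proj g n := (finite_rank g g n).

Lemma finite_rank_adjoint g h n : adjoint (finite_rank g h n) = finite_rank h g n.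
Proof.
apply: boundedOp_inner_ext => x y; rewrite inner_adjointl !finite_rankE.
rewrite inner_suml inner_sumr; apply: eq_bigr => i _.
by rewrite innerZl innerZr mulrC (innerC (g i)).
Qed.

Lemma finite_rank_fixes g n k (c : nat -> C) : orthosys g -> (k <= n)%N ->
  proj g n (\sum_(0 <= i < k) c i *: g i) = \sum_(0 <= i < k) c i *: g i.
Proof.
move=> go kn; rewrite finite_rankE (@big_cat_nat _ _ _ k)//=.
rewrite [Y in _ + Y]big_nat [Y in _ + Y]big1 ?addr0 => [|i /andP[ki _]]; last first.
  by rewrite orthosys_coef// ltnNge ki mulr0 scale0r.
rewrite big_nat [RHS]big_nat; apply: eq_bigr => i /andP[_ ik].
rewrite orthosys_coef// ik/=; have [->|_] := eqVneq (g i) 0.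
  by rewrite !scaler0.
by rewrite mulr1.
Qed.

(** The operator takes [g_i] to [h_i]. As the same indices carry zero vectors in both systems, it is
    a partial isometry whose initial space is the span of the [g_i]. *)
Lemma finite_rank_conj g h n : orthosys g -> orthosys h ->
  (forall i, (i < n)%N -> (g i == 0) = (h i == 0)) ->
  adjoint (finite_rank g h n) * finite_rank g h n = proj g n.
Proof.
move=> go ho gh; rewrite finite_rank_adjoint; apply: boundedOp_ext => x.
rewrite boundedOp_mulE !finite_rankE big_nat [RHS]big_nat.
apply: eq_bigr => i /andP[_ i_n]; rewrite orthosys_coef// i_n/= -gh//.
by have [->|_] := eqVneq (g i) 0; rewrite ?scaler0 ?mulr1.
Qed.

Lemma proj_idem g n : orthosys g -> proj g n * proj g n = proj g n.
Proof.
by move=> go; rewrite -{1}finite_rank_adjoint finite_rank_conj.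
Qed.

Lemma proj_selfadj g n x y : inner (proj g n x) y = inner x (proj g n y).
Proof. by rewrite adjointP finite_rank_adjoint. Qed.

Lemma proj_norm g n x : orthosys g -> `|proj g n x| <= `|x|.
Proof.
move=> go; have [->|P0] := eqVneq (proj g n x) 0; first by rewrite normr0.
rewrite -(@ler_pM2r _ `|proj g n x|) ?normr_gt0// -expr2 -inner_norm.
rewrite proj_selfadj -boundedOp_mulE proj_idem//.
rewrite -[leLHS]ger0_norm ?cauchy_schwarz//.
by rewrite -proj_idem// boundedOp_mulE -proj_selfadj inner_norm exprn_ge0.
Qed.

Lemma proj_bessel g n x : orthosys g ->
  \sum_(0 <= i < n) `|inner x (g i)| ^+ 2 <= `|x| ^+ 2.
Proof.
move=> go; apply: (@le_trans _ _ (`|proj g n x| ^+ 2)).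
  rewrite finite_rankE orthosys_sqnorm ?iota_uniq//.
  apply: ler_sum => i _; have [->|_] := eqVneq (g i) 0.
    by rewrite inner0r normr0 expr0n mul0r.
  by rewrite mulr1.
by rewrite ler_pXn2r ?nnegrE// proj_norm.
Qed.

End FiniteRank.

(** * Compact operators: compression, codes, and membership in the hull *)

Section CompactOperators.
Variables (R : realType) (H : hilbertType R).
Local Notation boundedOp := (boundedOp H).
Local Notation C := R[i].
Implicit Types (x y u v : H) (g h : nat -> H) (S T : boundedOp).
Local Notation proj g n := (finite_rank g g n).

Lemma compact_net T (e : R) : compact_op T -> 0 < e ->
  exists ys : seq H, forall x, `|x| <= 1 ->
    exists2 y, y \in ys & `|T x - y| < e%:C.
Proof.
rewrite /compact_op /= precompactE compact_cover => Tc e0.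
have e0' : 0 < e%:C by rewrite ltcR.
have [||D _ Dcov] := Tc H setT (fun y => ball y e%:C).
- by move=> y _; exact: ball_open.
- by move=> x _; exists x => //; exact: ballxx.
exists (finmap.enum_fset D) => x x1.
have [|y /= yD xy] := Dcov (T x); first by apply: subset_closure; exists x.
by exists y => //; move: xy; rewrite -ball_normE /ball_/= distrC.
Qed.

(* If [P] projects onto a net of the image of the ball, then [P T] is close to
   [T]; enlarging [P] to [Q], whose range also contains the vectors [T^* g_k],
   gives [P T Q = P T], without using that [T^*] is compact. *)
Lemma compact_compression T (e : R) : compact_op T -> 0 < e ->
  exists g n, orthosys g /\ forall x y,
    `|inner (T x) y - inner (T (proj g n x)) (proj g n y)| <= e%:C * `|x| * `|y|.
Proof.
move=> Tc e0; have e40 : 0 < e / 4 by rewrite divr_gt0.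
have [ys ysP] := compact_net Tc e40.
pose m := size ys.
have [g [go gF]] := gram_schmidt (fun s => if (size s < m)%N then nth 0 ys (size s)
  else adjoint T (nth 0 s (size s - m))).
exists g, (m + m)%N; split=> // x y.
pose P := proj g m; pose Q := proj g (m + m).
have Pys v : v \in ys -> P v = v.
  move=> /(nthP 0)[k km <-]; have := gF k; rewrite size_mkseq km => ->.
  exact: finite_rank_fixes.
have QP u : Q (P u) = P u.
  by rewrite /P finite_rankE finite_rank_fixes// leq_addr.
have PQ u : P (Q u) = P u.
  by apply: inner_inj => v; rewrite -!proj_selfadj -/P -/Q QP.
have QTg k : (k < m)%N -> Q (adjoint T (g k)) = adjoint T (g k).
  move=> km; have := gF (m + k)%N.
  rewrite size_mkseq ltnNge leq_addr/= addKn nth_mkseq; last first.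
    by rewrite -[X in (X < _)%N]add0n ltn_add2r (leq_ltn_trans _ km).
  move=> ->; apply: finite_rank_fixes => //.
  by rewrite -addnS leq_add2l.
have QTP u : Q (adjoint T (P u)) = adjoint T (P u).
  rewrite /P finite_rankE !op_sum big_nat [RHS]big_nat.
  by apply: eq_bigr => i /andP[_ im]; rewrite !opZ QTg.
have TP1 u : `|u| <= 1 -> `|T u - P (T u)| <= (e / 2)%:C.
  move=> /ysP[v /Pys Pv Tv].
  (* As [P v = v], the vector [T u - P (T u)] equals [(1 - P) (T u - v)]; each of its two terms has
     norm at most [e / 4]. *)
  have -> : (e / 2)%:C = (e / 4)%:C + (e / 4)%:C.
    by rewrite -rmorphD/=; congr (_%:C); field.
  have -> : T u - P (T u) = (T u - v) - P (T u - v).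
    by rewrite opB Pv opprB addrA subrK.
  rewrite (le_trans (ler_normB _ _))// lerD ?(ltW Tv)//.
  by rewrite (le_trans (proj_norm _ _ go))// ltW.
have TP u : `|T u - P (T u)| <= (e / 2)%:C * `|u|.
  have [->|u0] := eqVneq u 0; first by rewrite !op0 subrr !normr0 mulr0.
  rewrite -ler_pdivrMr ?normr_gt0//.
  have := TP1 (`|u|^-1 *: u); rewrite normfZV// lexx => /(_ isT).
  by rewrite !opZ -scalerBr normrZ normfV normr_id mulrC.
(* [<P T x, y> = <P T Q x, Q y>] because [P Q = P] and [Q T^* P = T^* P]. Subtracting it leaves two
   terms with the factor [(1 - P) T], each at most [e / 2]. *)
have -> : inner (T x) y - inner (T (Q x)) (Q y) =
    inner (T x - P (T x)) y - inner (T (Q x) - P (T (Q x))) (Q y).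
  rewrite !innerBl !proj_selfadj -/P -/Q PQ.
  have -> : inner (T (Q x)) (P y) = inner (T x) (P y).
    by rewrite adjointP proj_selfadj -/Q QTP -adjointP.
  by rewrite opprB addrA subrK.
have -> : e%:C * `|x| * `|y| = (e / 2)%:C * `|x| * `|y| + (e / 2)%:C * `|x| * `|y|.
  by rewrite -!mulrDl -rmorphD/=; congr (_%:C * _ * _); field.
have e20 : 0 <= (e / 2)%:C by rewrite lecR divr_ge0// ltW.
rewrite (le_trans (ler_normB _ _))// lerD// (le_trans (cauchy_schwarz _ _))//.
  by rewrite ler_wpM2r.
rewrite ler_pM// ?proj_norm// (le_trans (TP _))// ler_wpM2l//.
exact: proj_norm.
Qed.

Lemma floor_eq_dist (s t : R) : Num.floor s = Num.floor t -> `|s - t| <= 1.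
Proof.
move=> st; have := Num.Theory.floor_itv s; have := Num.Theory.floor_itv t.
by rewrite st intrD ler_norml => /andP[a b] /andP[c d]; apply/andP; split; lra.
Qed.

Definition grid_code (M : R) (z : C) : int * int :=
  (Num.floor (M * complex.Re z), Num.floor (M * complex.Im z)).

Lemma grid_code_dist (M : R) (z w : C) : 0 < M ->
  grid_code M z = grid_code M w -> `|z - w| <= (2 / M)%:C.
Proof.
move=> M0 [/floor_eq_dist re /floor_eq_dist im].
have scale (s t : R) : `|M * s - M * t| <= 1 -> `|s - t| <= M^-1.
  by rewrite -mulrBr normrM gtr0_norm// -ler_pdivlMl// mulr1.
have -> : z - w = (complex.Re z - complex.Re w)%:C +
    'i * (complex.Im z - complex.Im w)%:C.
  by case: z w {re im} => a b [c d]; rewrite [LHS]complexE.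
rewrite (le_trans (ler_normD _ _))// normrM norm_i.
rewrite mul1r !normc_def/= !expr0n/= !addr0 !sqrtr_sqr -rmorphD lecR.
by rewrite mulrDl mul1r lerD// scale.
Qed.

Lemma orthosys_norm_le1 g i : orthosys g -> `|g i| <= 1.
Proof.
move=> go; rewrite -(@ler_pXn2r _ 2)// ?nnegrE// orthosys_norm// expr1n.
by case: (g i != 0).
Qed.

Lemma orthosys_inner_le g i x : orthosys g -> `|inner x (g i)| <= `|x|.
Proof.
move=> go; rewrite (le_trans (cauchy_schwarz _ _))// ler_piMr//.
exact: orthosys_norm_le1.
Qed.

Lemma finite_rank_form T g h n x y :
  inner (T (finite_rank g h n x)) (finite_rank g h n y) =
  \sum_(0 <= l < n) \sum_(0 <= l' < n)
    inner x (g l) * Num.conj (inner y (g l')) * inner (T (h l)) (h l').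
Proof.
rewrite !finite_rankE op_sum inner_suml; apply: eq_bigr => l _.
rewrite opZ inner_sumr; apply: eq_bigr => l' _.
by rewrite innerZl innerZr mulrA.
Qed.

(** Operators with equal codes have nearly equal matrices in their own systems [g] and [h], so the
    partial isometry from [g] to [h] carries one compression to the other. *)
Lemma compact_twins (I : Type) (a : I -> boundedOp) :
  ~ countable [set: I] -> (forall i, compact_op (a i)) ->
  exists i, forall e : R, 0 < e -> exists j g h n, [/\ j <> i,
    orthosys g,
    adjoint (finite_rank g h n) * finite_rank g h n = proj g n &
    `|a i - adjoint (finite_rank g h n) * a j * finite_rank g h n| <= e%:C].
Proof.
move=> Iunc ac.
have /choice[G GP] : forall p : nat * I, exists gn : (nat -> H) * nat,
    orthosys gn.1 /\ forall x y, `|inner (a p.2 x) y -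
      inner (a p.2 (proj gn.1 gn.2 x)) (proj gn.1 gn.2 y)|
      <= (p.1.+1%:R^-1 : R)%:C * `|x| * `|y|.
  move=> [k i]; have k0 : 0 < k.+1%:R^-1 :> R by rewrite invr_gt0.
  by have [g [n gP]] := compact_compression (ac i) k0; exists (g, n).
(* A compression has [n ^ 2] entries, each known up to [2 / M], so the total error is at most
   [2 / k.+1]. The successor keeps [M] positive when [n = 0]. *)
pose M k n : R := (n ^ 2 * k.+1).+1%:R.
have M0 k n : 0 < M k n by rewrite ltr0n.
(* The code records the length, the positions of the zero vectors, which [finite_rank_conj] has to
   match, and the rounded matrix. *)
pose code k i := let gn := G (k, i) in
  (gn.2, mkseq (fun l => gn.1 l == 0) gn.2,
   mkseq (fun l => mkseq (fun l' =>
     grid_code (M k gn.2) (inner (a i (gn.1 l)) (gn.1 l'))) gn.2) gn.2).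
have [i iP] := uncountable_twins code Iunc; exists i => e e0.
(* One [1 / k.+1] pays for the compression of [a i], two for the rounding. *)
have [k ke] : exists k, 3 / k.+1%:R < e.
  exists (Num.bound (3 / e)); rewrite ltr_pdivrMr ?ltr0n// mulrC -ltr_pdivrMr//.
  by rewrite (lt_le_trans (archi_boundP _)) ?divr_ge0 ?(ltW e0)// ler_nat.
have [j ji] := iP k; rewrite /code.
have := GP (k, i); have := GP (k, j); case: (G (k, i)) => g n; case: (G (k, j)) => h n'.
move=> /= [ho hP] [go gP] [nn']; subst n'.
move=> z0 gr; exists j, g, h, n; split=> //.
  apply: finite_rank_conj => // l ln.
  by have := congr1 (nth true ^~ l) z0; rewrite !nth_mkseq.
have {z0}gr l l' : (l < n)%N -> (l' < n)%N ->
    `|inner (a i (g l)) (g l') - inner (a j (h l)) (h l')| <= (2 / M k n)%:C.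
  move=> ln l'n; apply: grid_code_dist => //.
  have /(congr1 (nth (0, 0) ^~ l')) := congr1 (nth [::] ^~ l) gr.
  by rewrite !nth_mkseq.
apply: opnorm_le_form => [|x y]; first by rewrite lecR ltW.
have -> : (a i - adjoint (finite_rank g h n) * a j * finite_rank g h n) x =
  a i x - (adjoint (finite_rank g h n) * a j * finite_rank g h n) x by [].
rewrite innerBl inner_conj.
set c := finite_rank g h n.
rewrite -(subrK (inner (a i (proj g n x)) (proj g n y)) (inner (a i x) y)).
rewrite -addrA (le_trans (ler_normD _ _))//.
have {}ke : (k.+1%:R^-1 : R)%:C + (2 / k.+1%:R)%:C <= e%:C.
  by rewrite -rmorphD/= lecR; move: ke; set r : R := k.+1%:R^-1 => ke; lra.
rewrite -mulrA (le_trans _ (ler_wpM2r _ ke)) ?mulr_ge0// mulrDl mulrA lerD//.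
rewrite !finite_rank_form -sumrB.
under eq_bigr do rewrite -sumrB.
apply: (@le_trans _ _ (\sum_(0 <= l < n) \sum_(0 <= l' < n)
    (2 / M k n)%:C * (`|x| * `|y|))).
  rewrite (le_trans (ler_norm_sum _ _ _))// big_nat [leRHS]big_nat.
  apply: ler_sum => l /andP[_ ln].
  rewrite (le_trans (ler_norm_sum _ _ _))// big_nat [leRHS]big_nat.
  apply: ler_sum => l' /andP[_ l'n].
  rewrite -mulrBr normrM mulrC ler_pM ?gr// normrM norm_conjC.
  by rewrite ler_pM ?orthosys_inner_le.
rewrite !sumr_const_nat !subn0 -mulrnA -[leLHS]mulr_natr mulrAC.
rewrite ler_wpM2r ?mulr_ge0// -[X in _ * X](rmorph_nat (@real_complex R)).
rewrite -rmorphM/= lecR mulrAC ler_pdivrMr// -[leRHS]mulrA ler_wpM2l//.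
rewrite ler_pdivlMl ?ltr0n// -natrM ler_nat mulnC.
by rewrite -mulnn leqnSn.
Qed.

(** Stated for general [A] and [X] so as to serve both the unitization of the compact operators and
    [B(l_2)]. The index [j] supplies, in the second case, an operator from which 0 is reached. *)
Lemma compact_hull (I : Type) (a : I -> boundedOp) :
  ~ countable [set: I] -> (forall i, compact_op (a i)) ->
  exists i, (exists j, j <> i) /\ forall A X : set boundedOp,
    (forall g h n, A (finite_rank g h n)) ->
    (forall T, A T -> A (1 - T)) ->
    a @` [set~ i] `<=` X -> MCL A X 0 -> MCL A X (a i).
Proof.
move=> Iunc ac; have [i iP] := compact_twins Iunc ac; exists i; split.
  by have [j [_ [_ [_ [ji _ _ _]]]]] := iP 1 ltr01; exists j.
move=> A X Afr A1 aX X0.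
apply: closed_approx (@MCL_closed _ _ _ _) _ => e /iP.
move=> [j [g [h [n [ji go cc ai]]]]]; set c := finite_rank g h n in cc ai *.
(* [c^* c + p^* p = 1], and the second term of the combination is [p^* 0 p]. *)
pose p := 1 - proj g n.
have pp : adjoint p = p.
  apply: boundedOp_inner_ext => x y.
  by rewrite inner_adjointl innerBr innerBl proj_selfadj.
exists (adjoint c * a j * c + adjoint p * 0 * p); last by rewrite mulr0 mul0r addr0.
apply: MCL_comb => //.
- exact: Afr.
- exact: A1 (Afr _ _ _).
- by apply: MCL_sub; apply: aX; exists j.
- by rewrite cc pp /p mulrBl mul1r mulrBr mulr1 proj_idem// subrr subr0 addrC subrK.
Qed.

End CompactOperators.

(** * Quadratic forms tested on a dense set *)

Section DenseForms.
Variables (R : realType) (H : hilbertType R).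
Local Notation boundedOp := (boundedOp H).
Local Notation C := R[i].
Implicit Types (x y : H) (g f z : nat -> H) (S T : boundedOp) (D : set H).

Definition norm_dense D :=
  forall x (e : R), 0 < e -> exists2 y, D y & `|x - y| <= e%:C.

(** For an orthonormal system with zeros this is the linear span. Using the Fourier coefficients
    leaves only the length [n] to be chosen. *)
Definition fspan g : set H :=
  [set x | exists n, x = \sum_(0 <= i < n) inner x (g i) *: g i].

(** Replacing [x] by a point of [D] at distance [d] changes both sides by [O(d)]; the constant for
    [d <= 1] is [(2 |x| + 1) (|T| + M)]. *)
Lemma dense_quad_le T (M : R) D : norm_dense D -> 0 <= M ->
  (forall y, D y -> `|inner (T y) y| <= M%:C * `|y| ^+ 2) ->
  forall x, `|inner (T x) x| <= M%:C * `|x| ^+ 2.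
Proof.
move=> Dd M0 TM x; pose t := opnorm T; pose r := rnorm x.
have t0 : 0 <= t by exact: opnorm_ge0.
have r0 : 0 <= r by rewrite -ler0c rnormE.
pose q := complex.Re `|inner (T x) x|.
have qE : q%:C = `|inner (T x) x| by rewrite RRe_real ?normr_real.
suff h (d : R) : 0 < d -> d <= 1 -> q <= M * r ^+ 2 + d * ((2 * r + 1) * (t + M)).
  rewrite -qE -rnormE -rmorphXn -rmorphM/= lecR.
  apply/ler_addgt0Pr => e e0.
  pose K := (2 * r + 1) * (t + M).
  have K0 : 0 <= K by rewrite mulr_ge0 ?addr_ge0// mulr_ge0.
  have K1 : 0 < K + 1 by rewrite ltr_wpDl.
  have m0 : 0 < Num.min 1 (e / (K + 1)) by rewrite lt_min ltr01/= divr_gt0.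
  have := h _ m0; rewrite ge_min lexx => /(_ isT)/le_trans; apply.
  rewrite lerD2l -/K (@le_trans _ _ (e / (K + 1) * K))//.
    by rewrite ler_wpM2r// ge_min lexx orbT.
  by rewrite mulrAC ler_pdivrMr// ler_pM2l// lerDl.
move=> d0 d1; have [y Dy xy] := Dd x _ d0.
have yx : `|y| <= (r + d)%:C.
  rewrite -(subrK x y) (le_trans (ler_normD _ _))// rmorphD/= rnormE addrC.
  by rewrite lerD2l distrC.
have nle u v (s p : R) : 0 <= s -> `|u| <= s%:C -> `|v| <= p%:C ->
    `|inner (T u) v| <= (t * s * p)%:C.
  move=> s0 us vp; rewrite (le_trans (cauchy_schwarz _ _))// !rmorphM/= ler_pM//.
  by rewrite (le_trans (opnormP _ _))// ler_wpM2l// ler0c.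
rewrite -lecR qE.
rewrite (_ : inner (T x) x = inner (T y) y +
  (inner (T (x - y)) x + inner (T y) (x - y))); last first.
  by rewrite opB innerBl innerBr addrACA addrC addrA; ring.
have rd : 0 <= r + d by rewrite addr_ge0// ltW.
rewrite (le_trans (ler_normD _ _))//.
apply: (@le_trans _ _ ((M * (r + d) ^+ 2)%:C +
  ((t * d * r)%:C + (t * (r + d) * d)%:C))).
  rewrite lerD//.
    rewrite (le_trans (TM _ Dy))// rmorphM rmorphXn/= ler_wpM2l ?ler0c//.
    by rewrite ler_pXn2r ?nnegrE// ler0c.
  rewrite (le_trans (ler_normD _ _))// lerD// nle//; first exact: ltW.
  by rewrite rnormE.
rewrite -!rmorphD/= lecR.
have dd : d * d <= d by rewrite ler_piMr// ltW.
have Mdd : M * (d * d) <= M * d by rewrite ler_wpM2l.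
have tdd : t * (d * d) <= t * d by rewrite ler_wpM2l.
nra.
Qed.

Lemma opnorm_le_dense T D (M : R) : norm_dense D -> 0 <= M ->
  (forall x, D x -> `|inner (T x) x| <= M%:C * `|x| ^+ 2) ->
  `|T| <= (2 * M)%:C.
Proof.
move=> Dd M0 TM; rewrite rmorphM /= rmorph_nat.
apply: opnorm_le_quad; first by rewrite ler0c.
exact: dense_quad_le Dd M0 TM.
Qed.

(** Over the complex numbers the quadratic form determines the operator: this is the norm bound for
    [S - T] with [M = 0]. *)
Lemma dense_op_ext S T D : norm_dense D ->
  (forall x, D x -> inner (S x) x = inner (T x) x) -> S = T.
Proof.
move=> Dd ST; apply/eqP; rewrite -subr_eq0 -normr_le0.
have := @opnorm_le_dense (S - T) D 0 Dd (lexx 0); rewrite mulr0; apply => y Dy.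
by rewrite innerBl ST// subrr normr0 mul0r.
Qed.

End DenseForms.

(** * The standard basis of [l_2] *)

Section Ell2Basis.
Variable R : realType.
Local Notation H := (ell2 R).
Local Notation boundedOp := (boundedOp H).
Local Notation C := R[i].
Implicit Types (x y : H) (S T : boundedOp).

Lemma delta_square_summable k :
  (fun j => (j == k)%:R : C) \in @square_summable R.
Proof.
apply: (@square_summable_bounded _ _ 1) => n; rewrite /series/=.
have E j : Normc.normc ((j == k)%:R : C) ^+ 2 = (j == k)%:R.
  by case: (j == k); rewrite ?Normc.normc1 ?Normc.normc0 ?expr1n ?expr0n.
under eq_bigr do rewrite E.
have [kn|nk] := ltnP k n.
  rewrite (bigD1_seq k) ?mem_index_iota ?iota_uniq//= eqxx.
  by rewrite big1 ?addr0// => j /negPf ->.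
rewrite big_nat big1// => j /andP[_ jn].
by rewrite (_ : (j == k) = false)//; apply: ltn_eqF; exact: leq_trans nk.
Qed.

Definition delta k : H := Ell2 (delta_square_summable k).

Lemma inner_delta x k : inner x (delta k) = x k.
Proof.
apply: cvg_lim => //; apply: cvg_near_cst; exists k.+1 => // n /= kn.
rewrite /series/= (bigD1_seq k) ?mem_index_iota ?iota_uniq//= eqxx conjC1 mulr1.
by rewrite big1 ?addr0// => j /negPf jk; rewrite jk conjC0 mulr0.
Qed.

Lemma delta_neq0 k : delta k != 0.
Proof.
by apply/eqP => /(congr1 (fun x : H => x k))/=; rewrite eqxx => /eqP; rewrite oner_eq0.
Qed.

Lemma delta_orthosys : orthosys delta.
Proof.
move=> i j; rewrite inner_delta/= eq_sym.
have [->|//] := eqVneq i j; by rewrite delta_neq0.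
Qed.

Lemma delta_dense : norm_dense (fspan delta).
Proof.
move=> x e e0.
have e20 : 0 < e ^+ 2 by rewrite exprn_gt0.
have /asboolP xs := ell2P x.
have : series (fun k => Normc.normc (x k) ^+ 2) @ \oo --> ell2_sqnorm x by exact: xs.
move=> /cvgrPdist_lt/(_ _ e20)[n _ /(_ n (leqnn n))/= xn].
pose y := \sum_(0 <= i < n) x i *: delta i.
have yi i : inner y (delta i) = x i * (i < n)%N%:R.
  rewrite /y orthosys_coef//; last exact: delta_orthosys.
  by rewrite delta_neq0 andbT.
exists y.
  exists n; rewrite {1}/y big_nat [RHS]big_nat; apply: eq_bigr => i /andP[_ i_n].
  by rewrite yi i_n mulr1.
have P : y = finite_rank delta delta n x.
  by rewrite finite_rankE; apply: eq_bigr => i _; rewrite inner_delta.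
(* By Pythagoras the squared distance is the tail of the series of [|x|^2]. *)
have pyth : `|x - y| ^+ 2 = `|x| ^+ 2 - `|y| ^+ 2.
  have xy : inner x y = `|y| ^+ 2.
    rewrite -inner_norm P -[in LHS](proj_idem _ delta_orthosys) boundedOp_mulE.
    by rewrite -proj_selfadj.
  have yx : inner y x = `|y| ^+ 2 by rewrite -xy P proj_selfadj.
  by rewrite -inner_norm innerBl !innerBr !inner_norm xy yx subrr subr0.
rewrite -(@ler_pXn2r _ 2)// ?nnegrE ?ler0c ?(ltW e0)// pyth.
rewrite -(inner_norm x) [inner x x]ell2_innerE.
rewrite orthosys_sqnorm ?iota_uniq//; last exact: delta_orthosys.
have -> : \sum_(i <- index_iota 0 n) `|x i| ^+ 2 * (delta i != 0)%:R =
    (series (fun k => Normc.normc (x k) ^+ 2) n)%:C.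
  rewrite series_normcE big_mkord; apply: eq_bigr => i _.
  by rewrite delta_neq0 mulr1.
rewrite -rmorphB -rmorphXn lecR (le_trans (ler_norm _))// ltW//.
Qed.

End Ell2Basis.

(** * Compact operators on [l_2] *)

Section CompactEll2.
Variable R : realType.
Local Notation H := (ell2 R).
Local Notation boundedOp := (boundedOp H).
Local Notation C := R[i].
Implicit Types (x y : H) (S T : boundedOp).

(** This is the [N]-th power of the unilateral shift; its range is orthogonal to the vectors
    supported on the first [N] coordinates. *)
Lemma shift_isometry N : exists c : boundedOp, adjoint c * c = 1 /\
  forall x y, fspan (@delta R) x -> (forall i, (N <= i)%N -> inner y (@delta R i) = 0) ->
    inner (c x) y = 0.
Proof.
pose d := @delta R; have dO : orthosys d by exact: delta_orthosys.
pose s k := d (k + N)%N.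
have sO : orthosys s by move=> i j; rewrite /s dO eqn_add2r.
have [c cP] := synthesis sO (fun n x => proj_bessel n x dO).
have cE x : fspan d x -> exists n, x = \sum_(0 <= i < n) inner x (d i) *: d i /\
    c x = \sum_(0 <= i < n) inner x (d i) *: s i.
  move=> [n xE]; exists n; split=> //; apply: cP => i ni.
  by rewrite xE orthosys_coef// ltnNge ni mulr0.
exists c; split.
  apply: dense_op_ext (@delta_dense R) _ => x /cE[n [xE cxE]].
  rewrite boundedOp_mulE inner_adjointl boundedOp_oneE !inner_norm cxE [in RHS]xE.
  rewrite !orthosys_sqnorm ?iota_uniq//; apply: eq_bigr => i _.
  by rewrite !delta_neq0.
move=> x y /cE[n [_ ->]] yN; rewrite inner_suml big1// => i _.
by rewrite innerZl /s (innerC (d _)) yN ?leq_addl// conjc0 mulr0.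
Qed.

(** [T] is close to [P T P] with [P] of finite rank, and the range of [P] is nearly spanned by
    finitely supported vectors. A shift past all their supports makes [P c] small. *)
Lemma compact_small_compression T (e : R) : compact_op T -> 0 < e ->
  exists2 c : boundedOp, adjoint c * c = 1 & `|adjoint c * T * c| <= e%:C.
Proof.
move=> Tc e0; have e40 : 0 < e / 4 by rewrite divr_gt0.
have [g [n [go gT]]] := compact_compression Tc e40.
pose t := opnorm T; have t0 : 0 <= t by exact: opnorm_ge0.
(* With the [g_i] approximated within [w], [|P c x| <= n w |x|], so the form of [T] at [P c x] is at
   most [t (n w)^2 |x|^2]. Keeping [w <= 1] gives [w^2 <= w]. *)
have [w w0 tw] : exists2 w : R, 0 < w & t * (n%:R * w) ^+ 2 <= e / 4.
  pose K := t * n%:R ^+ 2; have K0 : 0 <= K by rewrite mulr_ge0// exprn_ge0.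
  exists (Num.min 1 (e / 4 / (K + 1))).
    by rewrite lt_min ltr01/= divr_gt0// ltr_wpDl.
  set u := Num.min _ _.
  have u0 : 0 <= u by rewrite le_min ler01/= divr_ge0 ?(ltW e40)// addr_ge0.
  have -> : t * (n%:R * u) ^+ 2 = K * (u * u) by rewrite /K; ring.
  apply: (@le_trans _ _ (K * (e / 4 / (K + 1)))).
    rewrite ler_wpM2l// (@le_trans _ _ u)//.
      by rewrite ler_piMr// ge_min lexx.
    by rewrite /u ge_min lexx orbT.
  by rewrite mulrA ler_pdivrMr ?ltr_wpDl// mulrC ler_pM2l// lerDl.
have /choice[y yP] : forall i, exists y, fspan (@delta R) y /\ `|g i - y| <= w%:C.
  by move=> i; have [y] := @delta_dense R (g i) _ w0; exists y.
have /choice[N NP] : forall i, exists N, forall k, (N <= k)%N ->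
    inner (y i) (delta R k) = 0.
  move=> i; have [[N yE] _] := yP i; exists N => k Nk.
  by rewrite yE orthosys_coef ?ltnNge ?Nk ?mulr0//; exact: delta_orthosys.
have [c [cc cP]] := shift_isometry (\max_(i < n) N i).
have cnorm x : `|c x| = `|x|.
  apply/eqP; rewrite -(@eqrXn2 _ 2)//; apply/eqP.
  by rewrite -!inner_norm -inner_adjointl -boundedOp_mulE cc.
exists c => //.
(* [opnorm_le_dense] loses a factor 2, so the form has to be bounded by [e / 2]. *)
have -> : e = 2 * (e / 2) by field.
apply: opnorm_le_dense (@delta_dense R) _ _ => [|x xD].
  by rewrite divr_ge0// ltW.
rewrite inner_conj -(subrK (inner (T (finite_rank g g n (c x)))
  (finite_rank g g n (c x))) (inner _ _)).
rewrite (le_trans (ler_normD _ _))//.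
have -> : (e / 2)%:C * `|x| ^+ 2 =
    (e / 4)%:C * `|c x| * `|c x| + (e / 4)%:C * `|x| ^+ 2.
  rewrite cnorm -mulrA -expr2 -mulrDl -rmorphD/=; congr (_%:C * _); by field.
rewrite lerD// (le_trans (cauchy_schwarz _ _))//.
have Pc : `|finite_rank g g n (c x)| <= (n%:R * w)%:C * `|x|.
  rewrite finite_rankE (le_trans (ler_norm_sum _ _ _))//.
  apply: (@le_trans _ _ (\sum_(0 <= i < n) w%:C * `|x|)).
    rewrite big_nat [leRHS]big_nat; apply: ler_sum => i /andP[_ i_n].
    rewrite normrZ (le_trans (ler_piMr _ _))//.
      exact: orthosys_norm_le1.
    (* The shifted vector [c x] is orthogonal to the finitely supported [y i]. *)
    have -> : inner (c x) (g i) = inner (c x) (g i - y i).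
      rewrite innerBr (cP x (y i))// ?subr0// => k Nk; apply: NP.
      exact: leq_trans (leq_bigmax (Ordinal i_n)) Nk.
    rewrite (le_trans (cauchy_schwarz _ _))// cnorm mulrC ler_wpM2r//.
    by have [] := yP i.
  rewrite sumr_const_nat subn0 -[leLHS]mulr_natl
    mulrA rmorphM/= ler_wpM2r//.
  by rewrite ler_wpM2r ?ler0c ?(ltW w0)// -(rmorph_nat (@real_complex R)).
rewrite (le_trans (ler_wpM2r _ (opnormP _ _)))// -mulrA -expr2.
apply: (@le_trans _ _ (t%:C * ((n%:R * w)%:C * `|x|) ^+ 2)).
  rewrite ler_wpM2l ?ler0c// ler_pXn2r ?nnegrE ?mulr_ge0 ?ler0c ?mulr_ge0 ?(ltW w0)//.
rewrite exprMn mulrA ler_wpM2r ?exprn_ge0//.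
by rewrite -rmorphXn -rmorphM lecR.
Qed.

Lemma compact_no_cstar_polyhedron (I : Type) (a : I -> boundedOp) :
  ~ countable [set: I] -> (forall i, compact_op (a i)) ->
  ~ cstar_polyhedron setT a.
Proof.
move=> Iunc ac [_ aP]; have [i [[j ji] iP]] := compact_hull Iunc ac.
apply: (aP i); apply: iP => //; apply: closed_approx (@MCL_closed _ _ _ _) _ => e e0.
have [c cc ce] := compact_small_compression (ac j) e0.
(* The zero coefficient turns the single-term combination [c^* a_j c] into the two-term form. *)
exists (adjoint c * a j * c + adjoint 0 * a j * 0).
  have Xj : MCL setT (a @` [set~ i]) (a j) by apply: MCL_sub; exists j.
  by apply: MCL_comb => //; rewrite cc mulr0 addr0.
by rewrite mulr0 addr0 sub0r normrN.
Qed.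

End CompactEll2.

(** * Diagonalization of finite blocks *)

Section Diagonalization.
Variables (R : realType) (H : hilbertType R).
Local Notation boundedOp := (boundedOp H).
Local Notation C := R[i].
Implicit Types (x y : H) (g h z : nat -> H) (S T : boundedOp).

Lemma self_adjoint_inner T x y : self_adjoint T ->
  inner (T x) y = inner x (T y).
Proof. by move=> Ts; rewrite adjointP Ts. Qed.

(** The spectral theorem for the Hermitian matrix [<T h_k, h_l>]: if [U A U^*] is diagonal with [U]
    unitary, the rows of [U] are the coordinates of the [z_i]. *)
Lemma finite_diagonalization T m h : self_adjoint T ->
  (forall k l, (k < m)%N -> (l < m)%N -> inner (h k) (h l) = (k == l)%:R) ->
  exists (z : nat -> H) (u : nat -> nat -> C), [/\
    forall i, z i = \sum_(0 <= k < m) u i k *: h k,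
    forall i j, (i < m)%N -> (j < m)%N -> inner (z i) (z j) = (i == j)%:R,
    forall i j, (i < m)%N -> (j < m)%N -> i != j -> inner (T (z i)) (z j) = 0 &
    forall k, (k < m)%N -> h k = \sum_(0 <= i < m) inner (h k) (z i) *: z i].
Proof.
move=> Ts ho; pose A : 'M[C]_m := \matrix_(k, l) inner (T (h k)) (h l).
have AA : map_mx Num.conj A^T = A.
  apply/matrixP => k l; rewrite !mxE self_adjoint_inner//.
  by rewrite [RHS]self_adjoint_inner// [RHS]innerC self_adjoint_inner.
have /orthomx_spectralP AE : A \is normalmx.
  by apply/normalmxP; rewrite AA.
pose U := spectralmx A; have Uu : U \is unitarymx by exact: spectral_unitarymx.
have UU : U *m map_mx Num.conj U^T = 1%:M by apply/unitarymxP.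
have UV : map_mx Num.conj U^T *m U = 1%:M by apply: mulmx1C.
have UAU : U *m A *m map_mx Num.conj U^T = diag_mx (spectral_diag A).
  rewrite {1}AE -/U invmx_unitary// !mulmxA UU mul1mx -mulmxA UU.
  by rewrite mulmx1.
(* [U] is extended by 0 to all natural indices. *)
pose u i k : C := oapp (fun i' => oapp (fun k' => U i' k') 0 (insub k)) 0 (insub i).
have uE (i k : 'I_m) : u i k = U i k by rewrite /u !valK.
pose z i := \sum_(0 <= k < m) u i k *: h k.
have zE (i : 'I_m) : z i = \sum_(k < m) U i k *: h k.
  by rewrite /z big_mkord; apply: eq_bigr => k _; rewrite uE.
have hE (k : 'I_m) : h k = \sum_(i < m) Num.conj (U i k) *: z i.
  under eq_bigr do rewrite zE scaler_sumr.
  rewrite exchange_big/= (bigD1 k)//=.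
  have E l : \sum_(i < m) Num.conj (U i k) *: (U i l *: h l) = (k == l)%:R *: h l.
    under eq_bigr do rewrite scalerA.
    rewrite -scaler_suml; congr (_ *: _).
    have /matrixP/(_ k l) := UV; rewrite !mxE => <-.
    by apply: eq_bigr => i _; rewrite !mxE.
  rewrite E eqxx scale1r big1 ?addr0// => l lk.
  by rewrite E eq_sym (negPf lk) scale0r.
have zz (i j : 'I_m) : inner (z i) (z j) = (i == j)%:R.
  rewrite !zE inner_suml.
  have /matrixP/(_ i j) := UU; rewrite !mxE => <-.
  apply: eq_bigr => k _; rewrite innerZl inner_sumr (bigD1 k)//=.
  rewrite big1 ?addr0 => [|l lk]; last first.
    by rewrite innerZr ho// val_eqE eq_sym (negPf lk) mulr0.
  by rewrite innerZr ho// eqxx mulr1 !mxE.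
exists z, u; split=> //.
- by move=> i j im jm; rewrite (zz (Ordinal im) (Ordinal jm)).
- move=> i j im jm ij.
  have /matrixP/(_ (Ordinal im) (Ordinal jm)) := UAU.
  rewrite [in RHS]mxE (_ : (_ == _) = false); last first.
    by apply/negbTE; apply: contra ij => /eqP/(congr1 val)/= ->.
  rewrite mulr0n => <-.
  rewrite (zE (Ordinal im)) (zE (Ordinal jm)) op_sum inner_suml mxE.
  under eq_bigr do rewrite opZ innerZl inner_sumr mulr_sumr.
  rewrite exchange_big/=; apply: eq_bigr => l _; rewrite !mxE mulr_suml.
  by apply: eq_bigr => k _; rewrite innerZr !mxE mulrA mulrAC.
move=> k km; rewrite {1}(hE (Ordinal km)) big_mkord.
apply: eq_bigr => i _; congr (_ *: _); rewrite (hE (Ordinal km)) inner_suml.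
rewrite (bigD1 i)//= innerZl zz eqxx mulr1 big1 ?addr0// => j ji.
by rewrite innerZl zz (negPf ji) mulr0.
Qed.

Lemma fspan_zero g x : x = 0 -> fspan g x.
Proof. by move=> ->; exists 0%N; rewrite big_geq. Qed.

(** Here [b k] is the block of [g k]. The new basis of a block is stored at the positions of its
    nonzero old vectors, with 0 elsewhere, so [z] needs no renumbering across blocks. *)
Lemma block_diagonalization T g (b : nat -> nat) : self_adjoint T -> orthosys g ->
  (forall k l, b k != b l -> inner (T (g k)) (g l) = 0) ->
  (forall j, exists K, forall k, g k != 0 -> b k = j -> (k < K)%N) ->
  exists z, [/\ orthosys z,
    forall p q, p != q -> inner (T (z p)) (z q) = 0 &
    forall k, fspan z (g k)].
Proof.
move=> Ts go gb /choice[K KP].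
pose r j := [seq k <- iota 0 (K j) | (b k == j) && (g k != 0)].
have rE j k : (k \in r j) = (b k == j) && (g k != 0).
  rewrite mem_filter mem_iota add0n leq0n /=.
  by have [/andP[/eqP bk gk]/=|//] := boolP ((b k == j) && (g k != 0)); exact: KP.
have ru j : uniq (r j) by rewrite filter_uniq ?iota_uniq.
have /choice[Z /choice[u ZP]] : forall j,
    exists (z : nat -> H), exists (u : nat -> nat -> C),
    let m := size (r j) in let h i := g (nth 0%N (r j) i) in [/\
    forall i, z i = \sum_(0 <= k < m) u i k *: h k,
    forall i j, (i < m)%N -> (j < m)%N -> inner (z i) (z j) = (i == j)%:R,
    forall i j, (i < m)%N -> (j < m)%N -> i != j -> inner (T (z i)) (z j) = 0 &
    forall k, (k < m)%N -> h k = \sum_(0 <= i < m) inner (h k) (z i) *: z i].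
  move=> j; apply: finite_diagonalization => // k l km lm.
  rewrite go nth_uniq//; have := mem_nth 0%N km; rewrite rE => /andP[_ ->].
  by rewrite andbT.
pose act p := p \in r (b p).
pose z p := if act p then Z (b p) (index p (r (b p))) else 0.
(* Distinct blocks are orthogonal, and [T] has no entries between them. *)
have cross i j k l : i != j ->
    inner (Z i k) (Z j l) = 0 /\ inner (T (Z i k)) (Z j l) = 0.
  move=> ij; have [Zi _ _ _] := ZP i; have [Zj _ _ _] := ZP j.
  rewrite Zi Zj op_sum !inner_suml.
  split; rewrite big_nat big1// => i' /andP[_ i'm];
    rewrite inner_sumr big_nat big1// => j' /andP[_ j'm].
    rewrite innerZl innerZr go (_ : (_ == _) = false) ?mulr0//.
    apply/negbTE; apply: contra ij => /eqP e.
    have := mem_nth 0%N i'm; have := mem_nth 0%N j'm.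
    rewrite -e !rE => /andP[/eqP bj _] /andP[/eqP bi _].
    by apply/eqP; rewrite -[LHS]bi -[RHS]bj.
  rewrite opZ innerZl innerZr gb ?mulr0//.
  have := mem_nth 0%N i'm; have := mem_nth 0%N j'm.
  by rewrite !rE => /andP[/eqP bj _] /andP[/eqP bi _]; rewrite bi bj.
have z0 p : (z p != 0) = act p.
  rewrite /z; have [ap|_] := boolP (act p); last by rewrite eqxx.
  have [_ Zo _ _] := ZP (b p).
  have im : (index p (r (b p)) < size (r (b p)))%N by rewrite index_mem.
  apply: contraNneq (oner_neq0 C) => Z0.
  by have /eqP := Zo _ _ im im; rewrite Z0 inner0l eqxx eq_sym.
have zo : orthosys z.
  move=> p q; rewrite z0 /z; have [ap|] := boolP (act p); last first.
    by move=> _; rewrite inner0l andbF.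
  rewrite andbT; have [aq|naq] := boolP (act q); last first.
    rewrite inner0r; have [pq|//] := eqVneq p q.
    by move: naq; rewrite -pq ap.
  have [bpq|bpq] := eqVneq (b p) (b q); last first.
    have [-> _] := cross _ _ (index p (r (b p))) (index q (r (b q))) bpq.
    by have [pq|//] := eqVneq p q; move: bpq; rewrite pq eqxx.
  have [_ Zo _ _] := ZP (b p); rewrite -bpq Zo ?index_mem//; last first.
    by rewrite bpq.
  have [->|pq] := eqVneq p q; first by rewrite eqxx.
  rewrite (_ : (_ == _) = false)//; apply/negbTE; apply: contra pq => /eqP pq; apply/eqP.
  by apply: index_inj pq; rewrite // bpq.
exists z; split=> //.
  move=> p q pq; rewrite /z; case: ifP => ap; last by rewrite op0 inner0l.
  case: ifP => aq; last by rewrite inner0r.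
  have [bpq|bpq] := eqVneq (b p) (b q); last first.
    by have [_ ->] := cross _ _ (index p (r (b p))) (index q (r (b q))) bpq.
  have [_ _ Zd _] := ZP (b p); rewrite -bpq Zd ?index_mem//; first by rewrite bpq.
  apply: contra pq => /eqP pq; apply/eqP.
  by apply: index_inj pq; rewrite // bpq.
move=> k; have [/fspan_zero//|gk] := eqVneq (g k) 0.
have ak : act k by rewrite /act rE eqxx.
have [_ _ _ Zs] := ZP (b k).
exists (K (b k)).
have km : (index k (r (b k)) < size (r (b k)))%N by rewrite index_mem.
have := Zs _ km; rewrite nth_index// => gkE.
(* Positions outside the list [r (b k)] contribute 0; the remaining ones, reordered, give the
   expansion within the block. *)
rewrite {1}gkE [RHS](bigID (fun p => p \in r (b k)))/= [X in _ = _ + X]big1 ?addr0.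
  rewrite -[RHS]big_filter [RHS](perm_big (r (b k)))/=; last first.
    apply: uniq_perm => // [|p]; first by rewrite filter_uniq ?iota_uniq.
    rewrite mem_filter; apply: andb_idr.
    by rewrite /index_iota subn0 /r mem_filter => /andP[].
  rewrite [RHS](big_nth 0%N); rewrite big_nat [RHS]big_nat.
  apply: eq_bigr => i /andP[_ im].
  have pr := mem_nth 0%N im.
  have bp : b (nth 0%N (r (b k)) i) = b k by move: pr; rewrite rE => /andP[/eqP].
  by rewrite /z /act bp pr index_uniq.
move=> p npr; rewrite /z; case: ifP => ap; last by rewrite scaler0.
have bpk : b k != b p by apply: contraNneq npr => ->.
rewrite gkE inner_suml big1 ?scale0r// => i _.
by have [e _] := cross _ _ i (index p (r (b p))) bpk; rewrite innerZl e mulr0.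
Qed.

End Diagonalization.

(** * Finite spans and diagonal operators *)

Section Spans.
Variables (R : realType) (H : hilbertType R).
Local Notation boundedOp := (boundedOp H).
Local Notation C := R[i].
Implicit Types (x y : H) (g h z : nat -> H) (S T : boundedOp).

Lemma fspan_leq g n m x : orthosys g -> (n <= m)%N ->
  x = \sum_(0 <= i < n) inner x (g i) *: g i ->
  x = \sum_(0 <= i < m) inner x (g i) *: g i.
Proof.
move=> go nm xE; rewrite -finite_rankE {2}xE.
by rewrite finite_rank_fixes// -xE.
Qed.

Lemma fspan_sum g n (c : nat -> C) (v : nat -> H) : orthosys g ->
  (forall k, (k < n)%N -> fspan g (v k)) ->
  fspan g (\sum_(0 <= k < n) c k *: v k).
Proof.
move=> go; elim: n => [|n IH] vg; first by rewrite big_geq//; exact: fspan_zero.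
have [m mE] := IH (fun k kn => vg _ (ltnW kn)); have [p pE] := vg _ (ltnSn n).
exists (maxn m p); rewrite big_nat_recr//= -finite_rankE opD opZ !finite_rankE.
by rewrite -(fspan_leq go (leq_maxl m p) mE) -(fspan_leq go (leq_maxr m p) pE).
Qed.

(** This is [synthesis] for the vectors [w_i g_i], which satisfy the Bessel bound as
    [|w_i| <= 1]. *)
Lemma diagonal_op g (w : nat -> R) : orthosys g -> (forall k, `|w k| <= 1) ->
  exists W : boundedOp, forall x n,
    x = \sum_(0 <= i < n) inner x (g i) *: g i ->
    W x = \sum_(0 <= i < n) ((w i)%:C * inner x (g i)) *: g i.
Proof.
move=> go w1; have E x i : inner x ((w i)%:C *: g i) = (w i)%:C * inner x (g i).
  rewrite innerZr; congr (_ * _).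
  by apply/eqP; rewrite eq_complex/= oppr0 !eqxx.
have [|W WP] := @synthesis _ _ (fun i => (w i)%:C *: g i) g go.
  move=> n x; apply: le_trans (proj_bessel n x go); apply: ler_sum => i _.
  rewrite E normrM exprMn ler_piMl ?exprn_ge0// exprn_ile1//.
  by rewrite normc_def/= expr0n/= addr0 sqrtr_sqr lecR.
exists W => x n xE; rewrite (WP x n).
  by apply: eq_bigr => i _; rewrite E.
by move=> i ni; rewrite E xE orthosys_coef// ltnNge ni !mulr0.
Qed.

Lemma span_form T g n (c d : nat -> C) :
  inner (T (\sum_(0 <= k < n) c k *: g k)) (\sum_(0 <= l < n) d l *: g l) =
  \sum_(0 <= k < n) \sum_(0 <= l < n) c k * Num.conj (d l) * inner (T (g k)) (g l).
Proof.
rewrite op_sum inner_suml; apply: eq_bigr => k _.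
rewrite opZ inner_sumr; apply: eq_bigr => l _.
by rewrite innerZl innerZr mulrA.
Qed.

End Spans.

(** * Block tridiagonal form and slowly varying cutoffs *)

Section Tridiagonalization.
Variable R : realType.
Local Notation H := (ell2 R).
Local Notation boundedOp := (boundedOp H).
Local Notation C := R[i].
Implicit Types (x y : H) (g z : nat -> H) (T : boundedOp).

(* The sequence [delta 0, T g_0, delta 1, T g_1, ...] is orthonormalized, so
   [T g_k] is a combination of [g_0, ..., g_(2k+1)]. *)
Lemma krylov_basis T : self_adjoint T -> exists g, [/\ orthosys g,
  norm_dense (fspan g) &
  forall k l, (k.*2.+1 < l)%N || (l.*2.+1 < k)%N -> inner (T (g k)) (g l) = 0].
Proof.
move=> Ts; pose F (s : seq H) :=
  if odd (size s) then T (nth 0 s (size s)./2) else delta R (size s)./2.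
have [g [go gF]] := gram_schmidt F.
have dg k : fspan g (delta R k).
  have := gF k.*2; rewrite /F size_mkseq odd_double doubleK => dE.
  by exists k.*2.+1.
have Tg k : T (g k) = \sum_(0 <= i < k.*2.+2) inner (T (g k)) (g i) *: g i.
  have := gF k.*2.+1; rewrite /F size_mkseq/= odd_double/= uphalf_double nth_mkseq//.
  lia.
have up k l : (k.*2.+1 < l)%N -> inner (T (g k)) (g l) = 0.
  by move=> kl; rewrite Tg orthosys_coef// ltnNge kl mulr0.
exists g; split=> // [x e e0|k l /orP[/up//|/up lk]].
  have [y [n yE] xy] := @delta_dense R x e e0; exists y => //.
  by rewrite yE; apply: fspan_sum.
by rewrite self_adjoint_inner// innerC lk conjc0.
Qed.

(** The level of [k] is the integer part of [log_2 (k + 1)]. An index [l <= 2k + 1] has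
    [l + 1 <= 2 (k + 1)], so [T] raises the level by at most one, and by symmetry lowers it by at
    most one. *)
Lemma tridiagonal_basis T : self_adjoint T ->
  exists g (lev : nat -> nat), [/\ orthosys g,
  norm_dense (fspan g),
  forall m, exists K, forall k, (lev k <= m)%N -> (k < K)%N &
  forall k l, ((lev k).+1 < lev l)%N \/ ((lev l).+1 < lev k)%N ->
    inner (T (g k)) (g l) = 0].
Proof.
move=> Ts; have [g [go gd gT]] := krylov_basis Ts.
pose lev k := trunc_log 2 k.+1.
have lev2 k l : (l <= k.*2.+1)%N -> (lev l <= (lev k).+1)%N.
  move=> lk; rewrite /lev -trunc_log2_double// leq_trunc_log//.
exists g, lev; split=> //.
  move=> m; exists (2 ^ m.+1)%N => k km.
  apply: leq_trans (ltnW (trunc_log_ltn k.+1 (ltnSn 1))) _.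
  by rewrite leq_exp2l.
move=> k l kl; apply: gT; rewrite !ltnNge; apply/orP.
case: kl => kl; [left|right]; apply/negP => /lev2; lia.
Qed.

Lemma cos_near1 (e : R) : 0 < e ->
  exists N, (0 < N)%N /\ 1 - cos (pi / 2 / N%:R) < e.
Proof.
move=> e0; have := @continuous_cos R 0 => /cvgrPdist_lt/(_ e e0)/nbhs_normP[d /= d0 dP].
have p0 : 0 <= pi / 2 :> R by rewrite divr_ge0// pi_ge0.
exists (Num.bound (pi / 2 / d)).+1; split=> //.
set N := (Num.bound _).+1; rewrite -[X in X - _](cos0 R); apply: le_lt_trans (ler_norm _) _; apply: dP => /=.
rewrite sub0r normrN ger0_norm ?divr_ge0 ?pi_ge0//.
rewrite ltr_pdivrMr ?ltr0n//.
rewrite (mulrC d) -ltr_pdivrMr//; apply: lt_le_trans (archi_boundP _) _.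
  by rewrite divr_ge0// ltW.
by rewrite ler_nat.
Qed.

Lemma sin_natpi n : sin (n%:R * pi) = 0 :> R.
Proof.
elim: n => [|n IH]; first by rewrite mul0r sin0.
by rewrite -natr1 mulrDl mul1r sinDpi IH oppr0.
Qed.

(* The weights are [cos (d m)] and [sin (d m)] at level [m], [d = pi / 2N]. In
   [sum_s W_s T W_s] the entry between levels [m] and [m'] is multiplied by
   [cos (d (m - m'))], that is, by [1] or [cos d] as [T] is tridiagonal. The
   entries within levels are half the sum of [T] and its conjugate by
   [U = (-1)^level], so the error is [(1 - cos d) / 2 (T - U T U)]. *)
Lemma selfadjoint_cutoff T (e : R) : self_adjoint T -> 0 < e ->
  exists g (N : nat) (lev : nat -> nat) (W : bool -> boundedOp)
    (w : bool -> nat -> R),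
  [/\ orthosys g, norm_dense (fspan g),
   forall s, exists2 c, [/\ (0 < N)%N,
     forall m, exists K, forall k, (lev k <= m)%N -> (k < K)%N &
     forall k l, ((lev k).+1 < lev l)%N \/ ((lev l).+1 < lev k)%N ->
       inner (T (g k)) (g l) = 0] &
     (forall k, (2 * N %| lev k + c)%N -> w s k = 0) /\
     forall x n, x = \sum_(0 <= i < n) inner x (g i) *: g i ->
       W s x = \sum_(0 <= i < n) ((w s i)%:C * inner x (g i)) *: g i,
   forall x, fspan g x -> `|W true x| ^+ 2 + `|W false x| ^+ 2 = `|x| ^+ 2 &
   forall x, fspan g x -> `|inner (T x) x - (inner (T (W true x)) (W true x) +
      inner (T (W false x)) (W false x))| <= e%:C * `|x| ^+ 2].
Proof.
move=> Ts e0; have [g [lev [go gd levK gT]]] := tridiagonal_basis Ts.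
pose t := opnorm T; have t0 : 0 <= t by exact: opnorm_ge0.
have t1 : 0 < t + 1 by rewrite ltr_wpDl.
have [N [N0 Ne]] := cos_near1 (divr_gt0 e0 t1).
pose d : R := pi / 2 / N%:R.
have N0' : N%:R != 0 :> R by rewrite pnatr_eq0 -lt0n.
(* As [d N = pi / 2], a shift of the level by [N] turns sine into cosine. Both weights are thus
   sines, and they vanish when [2 N] divides the shifted level because [2 N d = pi]. *)
pose cs (s : bool) := if s then N else 0%N.
pose w (s : bool) k : R := sin (d * (lev k + cs s)%:R).
have wtrue k : w true k = cos (d * (lev k)%:R).
  rewrite /w /= natrD mulrDr [X in _ + X](_ : _ = pi / 2) ?sinDpihalf//.
  by rewrite /d mulfVK.
have wfalse k : w false k = sin (d * (lev k)%:R) by rewrite /w /= addn0.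
have ww k l : w true k * w true l + w false k * w false l =
    cos (d * ((lev k)%:R - (lev l)%:R)).
  by rewrite !wtrue !wfalse mulrBr cosB.
have w1 s k : `|w s k| <= 1 by rewrite /w ler_norml sin_le1 sin_geN1.
have /choice[W WP] := fun s => diagonal_op go (w1 s).
have [U UP] : exists U : boundedOp, forall x n,
    x = \sum_(0 <= i < n) inner x (g i) *: g i ->
    U x = \sum_(0 <= i < n) (((-1) ^+ lev i)%:C * inner x (g i)) *: g i.
  by apply: diagonal_op => // k; rewrite normrX normrN1 expr1n.
exists g, N, lev, W, w; split=> //.
- move=> s; exists (cs s) => //; split=> //; last exact: WP.
  move=> k /dvdnP[q qE]; rewrite /w qE -(sin_natpi q); congr sin.
  by rewrite /d !natrM; field.
- move=> x [n xE]; rewrite !(WP _ _ n xE) !orthosys_sqnorm ?iota_uniq//.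
  rewrite {3}xE orthosys_sqnorm ?iota_uniq// -big_split/=; apply: eq_bigr => k _.
  rewrite -mulrDl; congr (_ * _); rewrite !normrM !exprMn -mulrDl.
  have -> : `|(w true k)%:C| ^+ 2 + `|(w false k)%:C| ^+ 2 = 1.
    rewrite !normc_def/= !expr0n/= !addr0 !sqrtr_sqr -!rmorphXn -rmorphD/=.
    by rewrite !real_normK ?num_real// wtrue wfalse cos2Dsin2.
  by rewrite mul1r.
move=> x [n xE].
pose q (y : H) := inner (T y) y.
have key : q x - (q (W true x) + q (W false x)) =
    ((1 - cos d) / 2)%:C * (q x - q (U x)).
  have -> : q x = \sum_(0 <= k < n) \sum_(0 <= l < n)
      inner x (g k) * Num.conj (inner x (g l)) * inner (T (g k)) (g l).
    by rewrite -span_form -xE.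
  rewrite /q !(WP _ _ n xE) (UP _ n xE) !span_form.
  rewrite -[X in _ - X]big_split/= -!sumrB mulr_sumr; apply: eq_bigr => k _.
  rewrite -[X in _ - X]big_split/= -!sumrB mulr_sumr; apply: eq_bigr => l _ /=.
  have cR (u : R) (z : C) : Num.conj (u%:C * z) = u%:C * Num.conj z.
    by rewrite rmorphM/=; congr (_ * _); apply/eqP; rewrite eq_complex/= oppr0 !eqxx.
  rewrite !cR.
  set A := inner (T _) _; set y := inner x (g k); set z := Num.conj _.
  (* The identity [key] is checked entry by entry: [A = 0] for levels further than one apart, both
     coefficients vanish for equal levels, and both are [1 - cos d] for adjacent ones. *)
  have E : ((1 - (w true k * w true l + w false k * w false l)) -
      (1 - cos d) / 2 * (1 - (-1) ^+ lev k * (-1) ^+ lev l))%:C * A = 0.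
    rewrite ww.
    have [far|near] := pselect ((lev k).+1 < lev l \/ (lev l).+1 < lev k)%N.
      by rewrite /A gT ?mulr0.
    have {near} [e0'|e0'|e0'] :
        [\/ lev k = lev l, lev k = (lev l).+1 | lev l = (lev k).+1].
      by case: (ltngtP (lev k) (lev l)) => h;
        [apply: Or33|apply: Or32|apply: Or31]; lia.
    - rewrite e0' subrr mulr0 cos0 subrr -exprMn mulrNN mulr1 expr1n subrr mulr0 subrr.
      by rewrite mul0r.
    - rewrite e0' -natr1 [X in cos X](_ : _ = d); last by ring.
      rewrite [X in X%:C](_ : _ = 0) ?mul0r//
        exprS mulN1r mulNr -expr2 sqrr_sign; by field.
    - rewrite e0' -natr1 [X in cos X](_ : _ = - d) ?cosN; last by ring.
      rewrite [X in X%:C](_ : _ = 0) ?mul0r//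
        exprS mulN1r mulrN -expr2 sqrr_sign; by field.
  apply/eqP; rewrite -subr_eq0 -[X in _ == X](mulr0 (y * z)) -E; apply/eqP.
  rewrite !(rmorphB, rmorphD, rmorphM)/=; ring.
have Un : `|U x| = `|x|.
  apply/eqP; rewrite -(@eqrXn2 _ 2)//; apply/eqP.
  rewrite (UP _ n xE) [in RHS]xE !orthosys_sqnorm ?iota_uniq//.
  apply: eq_bigr => k _; congr (_ * _); rewrite normrM exprMn.
  by rewrite rmorphXn rmorphN1 normrX normrN1 !expr1n mul1r.
have qb y : `|q y| <= t%:C * `|y| ^+ 2.
  rewrite (le_trans (cauchy_schwarz _ _))// expr2 mulrA ler_wpM2r//.
  exact: opnormP.
have c0 : 0 <= 1 - cos d by rewrite subr_ge0 cos_le1.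
rewrite -/(q x) -/(q _) -/(q (W false x)) key normrM.
rewrite (le_trans (ler_wpM2l _ (ler_normB _ _)))//.
rewrite (le_trans (ler_wpM2l _ (lerD (qb _) (qb _))))// Un.
rewrite -mulrDl mulrA ler_wpM2r ?exprn_ge0//.
rewrite normc_def/= expr0n/= addr0 sqrtr_sqr ger0_norm ?divr_ge0//.
rewrite -rmorphD -rmorphM/= lecR.
have -> : (1 - cos d) / 2 * (t + t) = (1 - cos d) * t by field.
apply: (@le_trans _ _ (e / (t + 1) * t)); first by rewrite ler_wpM2r// ltW.
by rewrite mulrAC ler_pdivrMr// ler_pM2l// lerDl.
Qed.

End Tridiagonalization.

(** * Splitting a self-adjoint operator into two diagonal pieces *)

Section SelfAdjointDecomposition.
Variable R : realType.
Local Notation H := (ell2 R).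
Local Notation boundedOp := (boundedOp H).
Local Notation C := R[i].
Implicit Types (x y : H) (g z : nat -> H) (T : boundedOp).

(** A multiple of [M] lies above [m] and at most at [n], and it differs from [n]. *)
Lemma divn_gap M m n : ~~ (M %| n)%N -> (m %/ M < n %/ M)%N -> (m.+1 < n)%N.
Proof.
case: M => [|M]; first by rewrite !divn0.
move=> Mn mn; have := ltn_ceil m (ltn0Sn M).
have : (0 < n %% M.+1)%N by rewrite lt0n.
have := divn_eq n M.+1; have : ((m %/ M.+1).+1 * M.+1 <= n %/ M.+1 * M.+1)%N.
  by rewrite leq_mul2r mn orbT.
move: (_ * _)%N ((n %/ _) * _)%N (n %% _)%N => u v r; lia.
Qed.

(* Each weight vanishes at the levels [m] with [2N | m + c], so it cuts the
   basis vectors into finite blocks between which [T] has no entries. *)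
Lemma selfadjoint_decomposition T (e : R) : self_adjoint T -> 0 < e ->
  exists (D : set H) (W : bool -> boundedOp) (z : bool -> nat -> H),
  [/\ norm_dense D,
   forall s, orthosys (z s) /\
     forall p q, p != q -> inner (T (z s p)) (z s q) = 0,
   forall s x, D x -> fspan (z s) (W s x),
   forall x, D x -> `|W true x| ^+ 2 + `|W false x| ^+ 2 = `|x| ^+ 2 &
   forall x, D x -> `|inner (T x) x - (inner (T (W true x)) (W true x) +
      inner (T (W false x)) (W false x))| <= e%:C * `|x| ^+ 2].
Proof.
move=> Ts e0.
have [g [N [lev [W [w [go gd gW WW TW]]]]]] := selfadjoint_cutoff Ts e0.
have /choice[z zP] : forall s, exists z, [/\ orthosys z,
    forall p q, p != q -> inner (T (z p)) (z q) = 0 &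
    forall k, w s k != 0 -> fspan z (g k)].
  move=> s; have [c [N0 levK gT] [w0 _]] := gW s.
  (* Dropping the vectors of weight 0 removes the levels at block boundaries; by [divn_gap] the
     remaining blocks are more than one level apart. *)
  pose gs k := if w s k == 0 then 0 else g k.
  have gso : orthosys gs.
    move=> k l; rewrite /gs; case: ifP => wk; first by rewrite inner0l eqxx andbF.
    case: ifP => wl; last exact: go.
    rewrite inner0r; have [kl|//] := eqVneq k l.
    by move: wk; rewrite kl wl.
  have N2 : (0 < 2 * N)%N by rewrite muln_gt0.
  have ndvd k : w s k != 0 -> ~~ (2 * N %| lev k + c)%N.
    by apply: contra => /w0 ->.
  have [||z [zo zd zs]] := @block_diagonalization _ _ T gs
      (fun k => ((lev k + c) %/ (2 * N))%N) Ts gso.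
  - move=> k l; rewrite /gs; case: ifPn => wk; first by rewrite op0 inner0l.
    case: ifPn => wl; first by rewrite inner0r.
    rewrite neq_ltn => /orP[/divn_gap|/divn_gap] h; apply: gT.
      by left; have := h (ndvd _ wl); lia.
    by right; have := h (ndvd _ wk); lia.
  - move=> j; have [K KP] := levK (j.+1 * (2 * N))%N; exists K => k _ bk.
    apply: KP; have := ltn_ceil (lev k + c) N2; rewrite bk.
    by move: (_ * _)%N => u; lia.
  exists z; split=> // k /negPf wk; have := zs k; by rewrite /gs wk.
exists (fspan g), W, z; split=> //.
- by move=> s; have [] := zP s.
- move=> s x [n xE]; have [c _ [_ WE]] := gW s; have [zo _ zs] := zP s.
  rewrite (WE _ _ xE) (eq_bigr (fun i => ((w s i)%:C * inner x (g i)) *: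
    (if w s i == 0 then 0 else g i))) => [|i _]; last first.
    by case: ifP => // /eqP ->; rewrite mul0r scale0r scaler0.
  apply: fspan_sum => // k _; case: ifPn => [_|/zs//].
  exact: fspan_zero.
Qed.

End SelfAdjointDecomposition.

(** * Matching eigenvalues of two diagonal operators *)

Section Matching.
Variables (R : realType) (H : hilbertType R).
Local Notation boundedOp := (boundedOp H).
Local Notation C := R[i].
Implicit Types (x y : H) (g z : nat -> H) (T : boundedOp).

(* [None] stands for an infinite set. *)
Definition card_code (A : set nat) : option nat :=
  if pselect (exists n, (A #= `I_n)%card) is left h then Some (projT1 (cid h)) else None.

(** Equal finite codes mean equal cardinalities; if both sets are infinite, [A] injects into the
    natural numbers, which inject into [B]. *)
Lemma card_code_inj (A B : set nat) : card_code A = card_code B ->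
  exists f : nat -> nat, (forall p, A p -> B (f p)) /\
    forall p q, A p -> A q -> f p = f q -> p = q.
Proof.
move=> AB; suff /pcard_leP[f] : (A #<= B)%card.
  exists f; split=> [p Ap|p q Ap Aq]; first exact: funS.
  by apply: inj; rewrite inE.
move: AB; rewrite /card_code.
case: pselect => [Af|Ainf]; case: pselect => [Bf|Binf] //.
  case: cid => n /= An; case: cid => m /= Bm [nm].
  move: Bm; rewrite -nm => Bm.
  by rewrite (card_le_eql An) (card_le_eqr Bm) card_lexx.
move=> _; apply: card_le_trans (card_leT A) _.
by apply: contrapT => /finite_setPn/finite_setP/Binf.
Qed.

(* The shift by [L >= M |T|] makes the floor nonnegative. *)
Definition diag_key T z (M : R) (L p : nat) : nat :=
  `|Num.floor (M * complex.Re (inner (T (z p)) (z p)) + L%:R)|%N.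

Definition diag_class T z M L j : set nat :=
  [set p | z p != 0 /\ diag_key T z M L p = j].

(** When [z] is an [orthosys] and [M |T| <= L], the keys lie between 0 and [2 L], so a finite list,
    an element of a countable type, describes all classes. *)
Definition diag_code T z (M : R) L : seq (option nat) :=
  mkseq (fun j => card_code (diag_class T z M L j)) (L.*2.+1).

Lemma diag_entry T z p : self_adjoint T ->
  inner (T (z p)) (z p) = (complex.Re (inner (T (z p)) (z p)))%:C.
Proof.
move=> Ts; rewrite RRe_real//; apply/CrealP.
by rewrite [RHS]self_adjoint_inner// [RHS]innerC.
Qed.

Lemma diag_match T T' z z' (M : R) L : orthosys z -> orthosys z' ->
  0 < M -> M * opnorm T <= L%:R -> M * opnorm T' <= L%:R ->
  diag_code T z M L = diag_code T' z' M L ->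
  exists f : nat -> nat,
    (forall p, z p != 0 -> z' (f p) != 0 /\
      `|complex.Re (inner (T (z p)) (z p)) -
        complex.Re (inner (T' (z' (f p))) (z' (f p)))| <= M^-1) /\
    forall p q, z p != 0 -> z q != 0 -> f p = f q -> p = q.
Proof.
move=> zo zo' M0 TL TL' codes.
have bound S g p : orthosys g -> M * opnorm S <= L%:R ->
    `|M * complex.Re (inner (S (g p)) (g p))| <= L%:R.
  move=> yo SL; rewrite normrM gtr0_norm//; apply: le_trans SL.
  rewrite ler_pM2l// -lecR (le_trans (normc_ge_Re _))//.
  rewrite (le_trans (orthosys_inner_le _ _ yo))//.
  rewrite (le_trans (opnormP _ _))// ler_piMr ?ler0c ?opnorm_ge0//.
  exact: orthosys_norm_le1.
have key_ge0 S g p : orthosys g -> M * opnorm S <= L%:R ->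
    0 <= Num.floor (M * complex.Re (inner (S (g p)) (g p)) + L%:R).
  move=> yo SL; have := bound S g p yo SL; rewrite ler_norml => /andP[lo _].
  by rewrite floor_ge0 -lerBlDr sub0r.
have key_le S g p : orthosys g -> M * opnorm S <= L%:R ->
    (diag_key S g M L p < L.*2.+1)%N.
  move=> yo SL; have := key_ge0 S g p yo SL; rewrite /diag_key.
  have := bound S g p yo SL; set u := M * _; rewrite ler_norml => /andP[_ uL].
  have : Num.floor (u + L%:R) <= L.*2.
    rewrite -(ler_int R) (le_trans (floor_le _))//.
    by rewrite -pmulrn -addnn natrD lerD2r.
  lia.
have /choice[f fP] : forall j, exists f : nat -> nat,
    (forall p, diag_class T z M L j p -> diag_class T' z' M L j (f p)) /\
    forall p q, diag_class T z M L j p -> diag_class T z M L j q ->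
      f p = f q -> p = q.
  move=> j; have [jL|Lj] := ltnP j L.*2.+1.
    apply: card_code_inj; have := congr1 (nth None ^~ j) codes.
    by rewrite !nth_mkseq.
  (* No key exceeds [2 L], so this class is empty and any map will do. *)
  exists id; split=> // p [_ kp].
  by have := key_le T z p zo TL; rewrite kp ltnNge Lj.
exists (fun p => f (diag_key T z M L p) p); split=> [p zp|p q zp zq fpq].
  have [zfp keys] := (fP (diag_key T z M L p)).1 p (conj zp erefl); split=> //.
  set u := complex.Re _; set v := complex.Re _.
  suff : `|(M * u + L%:R) - (M * v + L%:R)| <= 1.
    rewrite opprD addrACA subrr addr0 -mulrBr normrM gtr0_norm//.
    by rewrite -ler_pdivlMl// mulr1.
  apply: floor_eq_dist; move: keys; rewrite /diag_key -/u -/v.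
  have := key_ge0 T z p zo TL.
  have := key_ge0 T' z' (f (diag_key T z M L p) p) zo' TL'.
  rewrite -/u -/v; lia.
(* Each map preserves the key, so equal images come from one class, on which the map is
   injective. *)
have := (fP (diag_key T z M L p)).1 p (conj zp erefl).
have := (fP (diag_key T z M L q)).1 q (conj zq erefl).
rewrite fpq => -[_ kq] [_ kp].
apply: (fP (diag_key T z M L p)).2 => //; first by split=> //; rewrite -kp kq.
by rewrite fpq -kp kq.
Qed.

Lemma orthosys_synthesis z z' : orthosys z -> orthosys z' ->
  exists S : boundedOp, forall v n,
    v = \sum_(0 <= i < n) inner v (z i) *: z i ->
    S v = \sum_(0 <= i < n) inner v (z i) *: z' i.
Proof.
move=> zo zo'; have [S SP] := synthesis zo' (fun n x => proj_bessel n x zo).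
exists S => v n vE; apply: SP => i ni.
by rewrite vE orthosys_coef// ltnNge ni mulr0.
Qed.

(** [S] takes [z_p] to the matched [z'_(f p)]. Both forms are diagonal there with entries within
    [1 / M], so Bessel's inequality bounds the error by [|v|^2 / M]. *)
Lemma diag_transport T T' z z' (M : R) L : self_adjoint T -> self_adjoint T' ->
  orthosys z -> orthosys z' ->
  (forall p q, p != q -> inner (T (z p)) (z q) = 0) ->
  (forall p q, p != q -> inner (T' (z' p)) (z' q) = 0) ->
  0 < M -> M * opnorm T <= L%:R -> M * opnorm T' <= L%:R ->
  diag_code T z M L = diag_code T' z' M L ->
  exists S : boundedOp, forall v, fspan z v -> `|S v| = `|v| /\
    `|inner (T v) v - inner (T' (S v)) (S v)| <= M^-1%:C * `|v| ^+ 2.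
Proof.
move=> Ts Ts' zo zo' zd zd' M0 TL TL' codes.
have [f [fz finj]] := diag_match zo zo' M0 TL TL' codes.
(* [f] is injective only on the nonzero [z p]; the other targets are set to 0, which also makes [S]
   isometric on the span. *)
pose y p := if z p == 0 then 0 else z' (f p).
have y0 p : (y p != 0) = (z p != 0).
  rewrite /y; case: ifPn => [_|/fz[]//]; by rewrite eqxx.
have yo : orthosys y.
  move=> p q; rewrite y0 /y; case: ifPn => zp; first by rewrite inner0l andbF.
  rewrite andbT; case: ifPn => zq.
    rewrite inner0r; have [pq|//] := eqVneq p q.
    by move: zp; rewrite pq zq.
  rewrite zo' (fz _ zp).1 andbT; have [->|pq] := eqVneq p q; first by rewrite eqxx.
  rewrite (_ : (_ == _) = false)//; apply/negbTE; apply: contra pq => /eqP fpq.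
  by apply/eqP; exact: finj.
have [S SP] := orthosys_synthesis zo yo.
exists S => v [n vE]; have SE := SP v n vE; split.
  apply/eqP; rewrite -(@eqrXn2 _ 2)//; apply/eqP.
  rewrite SE [in RHS]vE !orthosys_sqnorm ?iota_uniq//.
  by apply: eq_bigr => p _; rewrite y0.
have -> : inner (T v) v = \sum_(0 <= p < n) inner v (z p) *
    Num.conj (inner v (z p)) * inner (T (z p)) (z p).
  rewrite -(diag_form (fun p => inner v (z p)) (fun p => inner v (z p))
    (iota_uniq 0 (n - 0)) zd).
  by rewrite -vE.
rewrite SE diag_form ?iota_uniq//; last first.
  move=> p q pq; rewrite /y; case: ifPn => zp; first by rewrite op0 inner0l.
  case: ifPn => zq; first by rewrite inner0r.
  by apply: zd'; apply: contra pq => /eqP fpq; apply/eqP; exact: finj.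
rewrite -sumrB.
apply: (@le_trans _ _ (\sum_(0 <= p < n) M^-1%:C * `|inner v (z p)| ^+ 2)).
  rewrite (le_trans (ler_norm_sum _ _ _))//; apply: ler_sum => p _.
  rewrite -mulrBr -normCK normrM normrX normr_id mulrC.
  rewrite ler_wpM2r ?exprn_ge0// /y; case: ifPn => [/eqP ->|zp].
    by rewrite !op0 !inner0l subrr normr0 ler0c invr_ge0 ltW.
  rewrite (diag_entry _ _ Ts) (diag_entry _ _ Ts') -rmorphB normc_def/= expr0n/= addr0.
  by rewrite sqrtr_sqr lecR (fz _ zp).2.
rewrite -mulr_sumr ler_wpM2l ?ler0c ?invr_ge0 ?(ltW M0)//.
exact: proj_bessel.
Qed.

(** With [c_s = S_s W_s], one [e] comes from the cutoff. The other comes from the two transports,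
    whose errors add up by [|W_true x|^2 + |W_false x|^2 = |x|^2]. *)
Lemma approx_by_transport T T' (D : set H) (W S : bool -> boundedOp) (e : R) :
  norm_dense D -> 0 <= e ->
  (forall x, D x -> `|W true x| ^+ 2 + `|W false x| ^+ 2 = `|x| ^+ 2) ->
  (forall x, D x -> `|inner (T x) x - (inner (T (W true x)) (W true x) +
      inner (T (W false x)) (W false x))| <= e%:C * `|x| ^+ 2) ->
  (forall s x, D x -> `|S s (W s x)| = `|W s x| /\
    `|inner (T (W s x)) (W s x) - inner (T' (S s (W s x))) (S s (W s x))|
      <= e%:C * `|W s x| ^+ 2) ->
  exists c : bool -> boundedOp,
    adjoint (c true) * c true + adjoint (c false) * c false = 1 /\
    `|T - (adjoint (c true) * T' * c true + adjoint (c false) * T' * c false)|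
      <= (2 * (e + e))%:C.
Proof.
move=> Dd e0 DW DT DS; exists (fun s => S s * W s); split.
  apply: dense_op_ext Dd _ => x Dx.
  rewrite boundedOp_addE innerDl !boundedOp_mulE !inner_adjointl !inner_norm.
  by rewrite (DS true _ Dx).1 (DS false _ Dx).1 DW.
apply: opnorm_le_dense Dd _ _ => [|x Dx]; first by rewrite addr_ge0.
have -> A B : (T - (A + B)) x = T x - (A x + B x) by [].
rewrite innerBl innerDl !inner_conj !boundedOp_mulE.
have hT := (DS true _ Dx).2; have hF := (DS false _ Dx).2; have := DT x Dx.
rewrite rmorphD mulrDl -[in X in _ -> _ <= _ + X](DW _ Dx) mulrDr.
move: hT hF; set t := inner _ _; set t' := inner _ _.
set f := inner _ _; set f' := inner _ _.
set q := inner _ _ => hT hF hq.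
rewrite [X in `|X|](_ : _ = (q - (t + f)) + ((t - t') + (f - f'))); last by ring.
by rewrite (le_trans (ler_normD _ _))// lerD// (le_trans (ler_normD _ _))// lerD.
Qed.

End Matching.

(** * Self-adjoint operators on [l_2] *)

Section SelfAdjointEll2.
Variable R : realType.
Local Notation H := (ell2 R).
Local Notation boundedOp := (boundedOp H).
Local Notation C := R[i].
Implicit Types (x y : H) (g z : nat -> H) (T : boundedOp).

Lemma selfadjoint_in_MCL (I : Type) (a : I -> boundedOp) :
  ~ countable [set: I] -> (forall i, self_adjoint (a i)) ->
  exists i, MCL setT (a @` [set~ i]) (a i).
Proof.
move=> Iunc asa.
pose P (ki : nat * I) (d : set H * (bool -> boundedOp) * (bool -> nat -> H)) :=
  let: (D, W, z) := d in let T := a ki.2 in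
  [/\ norm_dense D,
   forall s, orthosys (z s) /\
     forall p q, p != q -> inner (T (z s p)) (z s q) = 0,
   forall s x, D x -> fspan (z s) (W s x),
   forall x, D x -> `|W true x| ^+ 2 + `|W false x| ^+ 2 = `|x| ^+ 2 &
   forall x, D x -> `|inner (T x) x - (inner (T (W true x)) (W true x) +
      inner (T (W false x)) (W false x))| <= (ki.1.+1%:R^-1 : R)%:C * `|x| ^+ 2].
have /choice[G GP] : forall ki, exists d, P ki d.
  move=> [k i]; have k0 : 0 < k.+1%:R^-1 :> R by rewrite invr_gt0.
  have [D [W [z h]]] := selfadjoint_decomposition (asa i) k0.
  by exists (D, W, z).
pose L k i := Num.bound (k.+1%:R * opnorm (a i)).
have LP k i : k.+1%:R * opnorm (a i) <= (L k i)%:R.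
  by rewrite ltW// archi_boundP// mulr_ge0// opnorm_ge0.
(* The bound [L] belongs to the code, so that twins use the same shift and the same range of
   keys. *)
pose code k i := let z := (G (k, i)).2 in
  (L k i, diag_code (a i) (z true) k.+1%:R (L k i),
          diag_code (a i) (z false) k.+1%:R (L k i)).
have [i iP] := uncountable_twins code Iunc; exists i.
apply: closed_approx (@MCL_closed _ _ _ _) _ => e e0.
(* The cutoff and the transport each cost [1 / k.+1] in the form, and passing to the norm doubles
   the sum. *)
have [k ke] : exists k, 4 / k.+1%:R < e.
  exists (Num.bound (4 / e)); rewrite ltr_pdivrMr ?ltr0n// mulrC -ltr_pdivrMr//.
  by rewrite (lt_le_trans (archi_boundP _)) ?divr_ge0 ?(ltW e0)// ler_nat.
have [j ji codeE] := iP k.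
have LL : L k j = L k i := congr1 (fun c => c.1.1) codeE.
have LPj := LP k j; rewrite LL in LPj.
have codeT : diag_code (a j) ((G (k, j)).2 true) k.+1%:R (L k i) =
    diag_code (a i) ((G (k, i)).2 true) k.+1%:R (L k i).
  by rewrite -{1}LL; exact: (congr1 (fun c => c.1.2) codeE).
have codeF : diag_code (a j) ((G (k, j)).2 false) k.+1%:R (L k i) =
    diag_code (a i) ((G (k, i)).2 false) k.+1%:R (L k i).
  by rewrite -{1}LL; exact: (congr1 snd codeE).
have := GP (k, i); have := GP (k, j); move: codeT codeF.
case: (G (k, j)) => -[D' W'] z'; case: (G (k, i)) => -[D W] z /= codeT codeF.
move=> [_ zj _ _ _] [Dd zi Dz DW DT].
have k0 : 0 < k.+1%:R :> R by [].
have [ST STP] := diag_transport (asa i) (asa j) (zi true).1 (zj true).1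
  (zi true).2 (zj true).2 k0 (LP k i) LPj (esym codeT).
have [SF SFP] := diag_transport (asa i) (asa j) (zi false).1 (zj false).1
  (zi false).2 (zj false).2 k0 (LP k i) LPj (esym codeF).
have [|s x Dx|c [c1 cT]] := @approx_by_transport _ _ (a i) (a j) D W
    (fun s => if s then ST else SF) _ Dd _ DW DT.
- by rewrite invr_ge0.
- by case: s; [exact: STP (Dz true _ Dx)|exact: SFP (Dz false _ Dx)].
exists (adjoint (c true) * a j * c true + adjoint (c false) * a j * c false).
  have Xj : MCL setT (a @` [set~ i]) (a j) by apply: MCL_sub; exists j.
  exact: (MCL_comb _ _ Xj Xj).
apply: le_trans cT _; rewrite lecR.
by move: ke; set r : R := k.+1%:R^-1 => ke; lra.
Qed.

End SelfAdjointEll2.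

Unset Implicit Arguments.
Local Close Scope complex_scope.
Local Close Scope ring_scope.

Theorem theorem1p2 (R : realType) :
  (forall H : hilbertType R,
     ~ exists (I : Type) (a : I -> boundedOp H),
         [/\ ~ countable [set: I],
             forall i, compact_op (a i) &
             cstar0_polyhedron (compact_unitization H) a]) /\
  ((~ exists (I : Type) (a : I -> boundedOp (ell2 R)),
        [/\ ~ countable [set: I],
            forall i, compact_op (a i) &
            cstar_polyhedron setT a]) /\
   (~ exists (I : Type) (a : I -> boundedOp (ell2 R)),
        [/\ ~ countable [set: I],
            forall i, self_adjoint (a i) &
            cstar0_polyhedron setT a])).
Proof.
split=> [H|]; last split; move=> [I [a [Iunc aP]]].
- move=> [_ aX]; have [i [_ iP]] := compact_hull Iunc aP.
  apply: (aX i); apply: iP; last by apply: MCL_sub; right.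
  + exact: finite_rank_unitization.
  + exact: compl_unitization.
  + by move=> T; left.
- exact: compact_no_cstar_polyhedron.
move=> [_ aX]; have [i iP] := selfadjoint_in_MCL Iunc aP.
by apply: (aX i); apply: MCL_mono iP => T; left.
Qed.
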